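(* Let $M=\dim W_h$ and $K=\dim W_h-\dim V_h$. Suppose that $\{\phi_1,\dots,\phi_{M-K},\dots,\phi_M\}$ is a basis of the finite element space $W_h$ and that $\{\phi_1|_\Gamma,\dots,\phi_{M-K}|_\Gamma\}$ is a basis of the trace space $V_h$. Define the matrices $A,B\in\mathbb{R}^{M\times M}$ by $A_{ij}=a(\phi_i,\phi_j)$ and $B_{ij}=(\phi_i,\phi_j)_\Gamma$ for $1\le i,j\le M$, and the matrices $\tilde A,\tilde B\in\mathbb{R}^{(M-K)\times(M-K)}$ by $\tilde A_{ij}=a(\phi_i,\phi_j)$ and $\tilde B_{ij}=(\phi_i,\phi_j)_\Gamma$ for $1\le i,j\le M-K$. Then the generalized eigenvalue problems $A\mathbf{u}=\lambda B\mathbf{u}$ and $\tilde A\mathbf{x}=\lambda\tilde B\mathbf{x}$ have the same finite eigenvalues.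
   Context: Setting: $\Gamma$ is a closed (compact, without boundary) smooth surface contained in a bounded domain $\Omega\subset\mathbb{R}^3$, and $\mathcal{T}_h$ is a shape-regular tetrahedral partition of $\Omega$. For $T\in\mathcal{T}_h$ put $F_T=T\cap\Gamma$, and let $\mathcal{T}_h^\Gamma=\{T\in\mathcal{T}_h: \operatorname{meas}_2(F_T)\ne 0\}$ (if $F_T$ lies on the common face of two neighbouring tetrahedra, only one of them is kept in $\mathcal{T}_h^\Gamma$). Let $\omega_h=\bigcup_{T\in\mathcal{T}_h^\Gamma}T$. For a fixed integer $k\ge 1$, $W_h=\{\hat v_h\in C(\omega_h): \hat v_h|_T\in P_k(T)\ \forall T\in\mathcal{T}_h^\Gamma\}$, where $P_k(T)$ is the space of polynomials of degree at most $k$ on $T$, and $V_h=\{\hat v_h|_\Gamma: \hat v_h\in W_h\}$ is the space of traces on $\Gamma$. Bilinear forms: $a(u,v)=\int_\Gamma\nabla_\Gamma u\cdot\nabla_\Gamma v\,\mathrm{d}s$ with $\nabla_\Gamma$ the surface gradient, and $(u,v)_\Gamma=\int_\Gamma uv\,\mathrm{d}s$; applied to functions in $W_h$ they are evaluated on the traces on $\Gamma$. Finite eigenvalues: for two square matrices $A,B$ of the same size, the normal rank is $\operatorname{nrank}(A,B)=\max_{\beta\in\mathbb{C}}\operatorname{rank}(A-\beta B)$. A number $\lambda\in\mathbb{C}$ is called a finite eigenvalue of the generalized eigenvalue problem $A\mathbf{u}=\lambda B\mathbf{u}$ if $\operatorname{rank}(A-\lambda B)<\operatorname{nrank}(A,B)$.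 *)

(* Defs.v *)
From HB Require Import structures.
From mathcomp Require Import all_boot all_order all_algebra.
From mathcomp Require mpoly.

Set Implicit Arguments.
Unset Strict Implicit.
Unset Printing Implicit Defensive.

(* The notations of mpoly clash with those of mathcomp-analysis, so mpoly is
   imported only inside this module. *)
Module MPoly.
Import mpoly.
Local Open Scope ring_scope.

(* [msize p] is 1 + the total degree of p. *)
Definition is_poly_fun (R : comNzRingType) (n k : nat)
    (f : 'rV[R]_n -> R) : Prop :=
  exists p : {mpoly R[n]},
    (msize p <= k.+1)%N /\ forall x, f x = p.@[fun i => x 0 i].

End MPoly.

From mathcomp Require Import all_classical all_reals all_analysis.
From mathcomp Require Import complex.

Import Order.TTheory GRing.Theory Num.Theory.
Import numFieldNormedType.Exports.

Local Open Scope classical_set_scope.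
Local Open Scope ring_scope.

(* The library norm on 'rV[R]_3 is the sup norm; it induces the usual
   topology, but lengths below are Euclidean. *)
Definition dot (R : realType) (u v : 'rV[R]_3) : R :=
  \sum_(i < 3) u 0 i * v 0 i.

Definition enorm (R : realType) (u : 'rV[R]_3) : R := Num.sqrt (dot u u).

(* Meaningful for bounded sets only: [sup] is 0 on unbounded (and empty) sets. *)
Definition diam (R : realType) (A : set 'rV[R]_3) : R :=
  sup [set enorm (p.1 - p.2) | p in A `*` A].

Definition fine_cover (R : realType) (delta : R) (A : set 'rV[R]_3) :
    set (nat -> set 'rV[R]_3) :=
  [set C | (forall k x y, C k x -> C k y -> enorm (x - y) <= delta) /\
           A `<=` \bigcup_k C k].

(* The factor pi / 4 makes the measure agree with surface area. *)
Definition hausdorff2_delta (R : realType) (delta : R) (A : set 'rV[R]_3) :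
    \bar R :=
  ereal_inf [set (\sum_(0 <= k <oo) (pi / 4 * diam (C k) ^+ 2)%:E)%E
            | C in fine_cover delta A].

Definition hausdorff2 (R : realType) (A : set 'rV[R]_3) : \bar R :=
  ereal_sup [set hausdorff2_delta delta A | delta in [set d : R | 0 < d]].

Section HausdorffOuterMeasure.
Variable R : realType.
Notation E := 'rV[R]_3.
Notation D := (g_sigma_algebraType [set: set E]).

Let gauge (delta : R) (C : set D) : \bar R :=
  if `[< forall x y : E, C x -> C y -> enorm (x - y) <= delta >]
  then (pi / 4 * diam (C : set E) ^+ 2)%:E else +oo%E.

Let gauge_ge0 delta C : (0 <= gauge delta C)%E.
Proof.
rewrite /gauge; case: ifP => _; last exact: leey.
by rewrite lee_fin mulr_ge0 ?sqr_ge0// divr_ge0 ?pi_ge0.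
Qed.

Let gauge0 delta : gauge delta set0 = 0%E.
Proof.
rewrite /gauge asboolT; last by [].
by rewrite /diam set0X image_set0 sup0 expr0n/= mulr0.
Qed.

Let measD (C : set D) : measurable C.
Proof. exact: sub_sigma_algebra. Qed.

Let hausdorff2_deltaE delta (A : set E) :
  hausdorff2_delta delta A = mu_ext (gauge delta) (A : set D).
Proof.
apply/eqP; rewrite eq_le; apply/andP; split.
  apply: le_ereal_inf_tmp => _ [C [_ AC] <-].
  have [finC|] := pselect (forall k x y, C k x -> C k y ->
      enorm (x - y : E) <= delta).
    apply: ereal_inf_lbound; exists C => //.
    by apply: eq_eseriesr => k _; rewrite /gauge asboolT// => x y; exact: finC.
  move=> /existsNP[k nk].
  rewrite (_ : (\sum_(_ <= _ <oo) _)%E = +oo%E) ?leey//.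
  apply: (@eseries_pinfty _ _ _ k) => [i _|//|].
    by rewrite -ltNye (lt_le_trans _ (gauge_ge0 _ _)).
  by rewrite /gauge asboolF.
apply: le_ereal_inf_tmp => _ [C [finC AC] <-].
apply: ereal_inf_lbound; exists C; first by split => // i; exact: measD.
by apply: eq_eseriesr => k _; rewrite /gauge asboolT// => x y; exact: finC.
Qed.

Let pi_ge0E (C : set E) : (0 <= (pi / 4 * diam C ^+ 2)%:E)%E.
Proof. by rewrite lee_fin mulr_ge0 ?sqr_ge0// divr_ge0 ?pi_ge0. Qed.

Let hausdorff2_0 : hausdorff2 (set0 : set E) = 0%E.
Proof.
rewrite /hausdorff2 (_ : [set _ | _ in _] = [set 0%E]) ?ereal_sup1//.
apply/seteqP; split => [_ [d d0 <-]|_ ->].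
  by rewrite hausdorff2_deltaE; exact: mu_ext0.
by exists 1 => //=; rewrite hausdorff2_deltaE; exact: mu_ext0.
Qed.

Let hausdorff2_ge0 (A : set E) : (0 <= hausdorff2 A)%E.
Proof.
apply: (@le_trans _ _ (hausdorff2_delta 1 A)).
  by rewrite hausdorff2_deltaE; exact: mu_ext_ge0.
by apply: ereal_sup_ubound; exists 1 => //=.
Qed.

Let le_hausdorff2 : {homo @hausdorff2 R : A B / A `<=` B >-> (A <= B)%E}.
Proof.
move=> A B AB; apply: ge_ereal_sup => _ [d d0 <-].
apply: (@le_trans _ _ (hausdorff2_delta d B)).
  by rewrite !hausdorff2_deltaE; exact: le_mu_ext.
by apply: ereal_sup_ubound; exists d.
Qed.

Let hausdorff2_sigma_subadditive : sigma_subadditive (@hausdorff2 R).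
Proof.
move=> F; apply: ge_ereal_sup => _ [d d0 <-].
apply: (@le_trans _ _ (\sum_(0 <= i <oo) hausdorff2_delta d (F i))%E).
  rewrite hausdorff2_deltaE.
  under eq_eseriesr do rewrite hausdorff2_deltaE.
  exact: mu_ext_sigma_subadditive.
apply: lee_nneseries => [i _ _|i _].
  by rewrite hausdorff2_deltaE; exact: mu_ext_ge0.
by apply: ereal_sup_ubound; exists d.
Qed.

HB.instance Definition _ := isOuterMeasure.Build R E (@hausdorff2 R)
  hausdorff2_0 hausdorff2_ge0 le_hausdorff2 hausdorff2_sigma_subadditive.

End HausdorffOuterMeasure.

Definition hausdorff2_outer (R : realType) :
  {outer_measure set 'rV[R]_3 -> \bar R} := @hausdorff2 R.

(* [hausdorff2] on the sigma-algebra of its Caratheodory measurable sets. *)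
Definition surface_measure (R : realType) :
    {measure set (caratheodory_type (@hausdorff2_outer R)) -> \bar R} :=
  @hausdorff2_outer R : set (caratheodory_type (@hausdorff2_outer R)) -> \bar R.

Definition surface_integral (R : realType) (Gamma : set 'rV[R]_3)
    (f : 'rV[R]_3 -> R) : R :=
  \int[@surface_measure R]_(x in Gamma) f x.

(* C^oo on an open set U: every iterated partial derivative is differentiable. *)
Definition smooth_on (R : realType) (n m : nat) (U : set 'rV[R]_n.+1)
    (f : 'rV[R]_n.+1 -> 'rV[R]_m.+1) : Prop :=
  forall (s : seq 'I_n.+1) (q : 'rV[R]_n.+1), U q ->
    differentiable (foldr (fun i g => fun p => 'D_(delta_mx 0 i) g p) f s) q.

(* X : U -> V `&` Gamma is a smooth homeomorphism with injective differential. *)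
Definition local_parametrization (R : realType) (Gamma V : set 'rV[R]_3)
    (U : set 'rV[R]_2) (X : 'rV[R]_2 -> 'rV[R]_3) : Prop :=
  [/\ open U, X @` U = V `&` Gamma, smooth_on U X,
      exists2 Y : 'rV[R]_3 -> 'rV[R]_2,
        forall q, U q -> Y (X q) = q & {within V `&` Gamma, continuous Y} &
      forall q, U q -> injective ('d X q)].

Definition closed_smooth_surface (R : realType) (Gamma : set 'rV[R]_3) : Prop :=
  compact Gamma /\
  forall p, Gamma p -> exists V U X,
    [/\ open V, V p & local_parametrization Gamma V U X].

Definition tangent (R : realType) (Gamma : set 'rV[R]_3) (x v : 'rV[R]_3) :
    Prop :=
  exists c : R -> 'rV[R]_3,
    [/\ c 0 = x, \forall t \near (0 : R), Gamma (c t) & is_derive (0 : R) 1 c v].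

Definition is_surface_gradient (R : realType) (Gamma : set 'rV[R]_3)
    (u : 'rV[R]_3 -> R) (x g : 'rV[R]_3) : Prop :=
  tangent Gamma x g /\
  forall e : R, 0 < e -> \forall y \near within Gamma (nbhs x),
    `|u y - u x - dot g (y - x)| <= e * enorm (y - x).

(* The value 0 is a placeholder at the points where u is not differentiable
   along Gamma; for traces of piecewise polynomials these have measure 0. *)
Definition surface_gradient (R : realType) (Gamma : set 'rV[R]_3)
    (u : 'rV[R]_3 -> R) (x : 'rV[R]_3) : 'rV[R]_3 :=
  xget 0 [set g | is_surface_gradient Gamma u x g].

(* Both forms depend only on the values of u and v on Gamma. *)
Definition form_a (R : realType) (Gamma : set 'rV[R]_3)
    (u v : 'rV[R]_3 -> R) : R :=
  surface_integral Gamma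
    (fun x => dot (surface_gradient Gamma u x) (surface_gradient Gamma v x)).

Definition form_l2 (R : realType) (Gamma : set 'rV[R]_3)
    (u v : 'rV[R]_3 -> R) : R :=
  surface_integral Gamma (fun x => u x * v x).

Definition convex_hull (R : realType) (n : nat) (v : 'I_n -> 'rV[R]_3) :
    set 'rV[R]_3 :=
  [set x | exists l : 'I_n -> R,
     [/\ forall i, 0 <= l i, \sum_i l i = 1 & x = \sum_i l i *: v i]].

(* A mesh is a finite family of tetrahedra, each given by its four vertices. *)
Definition tet (R : realType) (I : finType) (Th : I -> 'I_4 -> 'rV[R]_3)
    (T : I) : set 'rV[R]_3 :=
  convex_hull (Th T).

(* The face opposite to the vertex of index j. *)
Definition face (R : realType) (I : finType) (Th : I -> 'I_4 -> 'rV[R]_3)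
    (T : I) (j : 'I_4) : set 'rV[R]_3 :=
  convex_hull (fun i : 'I_3 => Th T (lift j i)).

Definition nondegenerate_tet (R : realType) (v : 'I_4 -> 'rV[R]_3) : Prop :=
  \det (\matrix_(i < 3) (v (lift ord0 i) - v ord0)) != 0.

Definition bounded_domain (R : realType) (Omega : set 'rV[R]_3) : Prop :=
  [/\ Omega !=set0, open Omega, connected Omega & bounded_set Omega].

Definition tetrahedral_partition (R : realType) (Omega : set 'rV[R]_3)
    (I : finType) (Th : I -> 'I_4 -> 'rV[R]_3) : Prop :=
  [/\ forall T, nondegenerate_tet (Th T),
      \bigcup_T tet Th T = closure Omega &
      forall T T', T != T' -> interior (tet Th T) `&` interior (tet Th T') = set0].

Definition inball_diam (R : realType) (A : set 'rV[R]_3) : R :=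
  sup [set 2 * r | r in [set r : R | 0 <= r /\
        exists c, [set y | enorm (y - c) <= r] `<=` A]].

Definition shape_regular (R : realType) (kappa : R) (I : finType)
    (Th : I -> 'I_4 -> 'rV[R]_3) : Prop :=
  forall T, diam (tet Th T) <= kappa * inball_diam (tet Th T).

Definition cut_part (R : realType) (Gamma : set 'rV[R]_3) (I : finType)
    (Th : I -> 'I_4 -> 'rV[R]_3) (T : I) : set 'rV[R]_3 :=
  tet Th T `&` Gamma.

Definition on_common_face (R : realType) (Gamma : set 'rV[R]_3) (I : finType)
    (Th : I -> 'I_4 -> 'rV[R]_3) (T T' : I) : Prop :=
  exists j j' : 'I_4, face Th T j = face Th T' j' /\ cut_part Gamma Th T `<=` face Th T j.

(* The choice of which of two neighbours is dropped is left open: any selection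
   ThG obeying these rules is allowed. *)
Definition cut_mesh (R : realType) (Gamma : set 'rV[R]_3) (I : finType)
    (Th : I -> 'I_4 -> 'rV[R]_3) (ThG : {set I}) : Prop :=
  [/\ forall T, T \in ThG -> hausdorff2 (cut_part Gamma Th T) <> 0%E,
      forall T, hausdorff2 (cut_part Gamma Th T) <> 0%E -> T \notin ThG ->
        exists T', [/\ T' \in ThG, T' != T & on_common_face Gamma Th T T'] &
      forall T T', T \in ThG -> T' \in ThG -> T != T' ->
        ~ on_common_face Gamma Th T T'].

Definition omega_h (R : realType) (I : finType) (Th : I -> 'I_4 -> 'rV[R]_3)
    (ThG : {set I}) : set 'rV[R]_3 :=
  \bigcup_(T in [set T | T \in ThG]) tet Th T.

Definition poly_on (R : realType) (k : nat) (T : set 'rV[R]_3)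
    (f : 'rV[R]_3 -> R) : Prop :=
  exists g : 'rV[R]_3 -> R, MPoly.is_poly_fun k g /\ forall x, T x -> f x = g x.

(* A function on a subset of R^3 is represented by its extension by 0, so that
   equality of functions on R^3 is equality on the subset. *)
Definition Wh (R : realType) (k : nat) (I : finType)
    (Th : I -> 'I_4 -> 'rV[R]_3) (ThG : {set I}) : set ('rV[R]_3 -> R^o) :=
  [set f | [/\ forall x, ~ omega_h Th ThG x -> f x = 0,
               {within omega_h Th ThG, continuous f} &
               forall T, T \in ThG -> poly_on k (tet Th T) f]].

Definition trace (R : realType) (Gamma : set 'rV[R]_3)
    (f : 'rV[R]_3 -> R^o) : 'rV[R]_3 -> R^o :=
  f \_ Gamma.

Definition Vh (R : realType) (Gamma : set 'rV[R]_3) (k : nat) (I : finType)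
    (Th : I -> 'I_4 -> 'rV[R]_3) (ThG : {set I}) : set ('rV[R]_3 -> R^o) :=
  trace Gamma @` Wh k Th ThG.

Definition is_basis (F : fieldType) (V : lmodType F) (S : set V) (n : nat)
    (b : 'I_n -> V) : Prop :=
  [/\ forall i, S (b i),
      forall c : 'I_n -> F, \sum_i c i *: b i = 0 -> forall i, c i = 0 &
      forall v, S v -> exists c : 'I_n -> F, v = \sum_i c i *: b i].

(* Meaningful for finite-dimensional subspaces S. *)
Definition subspace_dim (F : fieldType) (V : lmodType F) (S : set V) : nat :=
  xget 0%N [set n | exists b : 'I_n -> V, is_basis S b].

Definition nrank (F : fieldType) (n : nat) (A B : 'M[F]_n) : nat :=
  \max_(r < n.+1 | `[< exists beta : F, \rank (A - beta *: B) = r >]) r.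

Definition finite_eigenvalue (F : fieldType) (n : nat) (A B : 'M[F]_n)
    (lambda : F) : Prop :=
  (\rank (A - lambda *: B)%R < nrank A B)%N.

Definition complexify (R : realType) (m n : nat) (A : 'M[R]_(m, n)) :
    'M[R[i]]_(m, n) :=
  map_mx (real_complex R) A.

(* Main.v *)
(* Each trace phi_l|_Gamma is a combination of the first M - K traces, so
   A = P At P^T and B = P Bt P^T for an M x (M - K) matrix P whose first rows
   form the identity, provided that both forms are bilinear on traces of W_h;
   congruence by P then preserves the rank of every pencil A - beta B.

   Bilinearity is the analytic part.  Surface gradients of traces combine
   linearly only where they exist, and integrals only of integrable functions.
   If polynomial pieces p, q meet at x in Gamma, then (p - q)(x) = 0, and the
   set where p - q vanishes on Gamma with nonzero surface gradient is locally a
   Lipschitz curve, hence H^2-null; together with the null cut parts T /\ Gamma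
   this is the exceptional set.  At every other point all pieces containing x
   have the same surface gradient, which is therefore that of the trace.  The
   integrands are thus a.e. piecewise continuous on the compact set Gamma,
   which has finite H^2 measure (Lipschitz charts), and Borel sets are
   Caratheodory measurable for H^2. *)
Require Import Defs.
From mathcomp Require Import all_boot all_order all_algebra.
From mathcomp Require Import all_classical all_reals all_analysis.
From mathcomp Require Import complex finmap.
From mathcomp Require Import measurable_realfun.
From mathcomp Require Import ring lra zify.

Import Order.TTheory GRing.Theory Num.Theory.
Import numFieldNormedType.Exports.

Set Implicit Arguments.
Unset Strict Implicit.
Unset Printing Implicit Defensive.

Local Open Scope classical_set_scope.
Local Open Scope ring_scope.

(** No surface integral is ever evaluated: the measure enters only through null sets, the finiteness
    of [hausdorff2 Gamma] and the measurability of closed sets. The obstacle is that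
    [surface_gradient] is a choice with default value 0, from which nothing can be computed before a
    gradient is known to exist. Each identity for it is proved by exhibiting a gradient and invoking
    uniqueness: existence comes from projecting the ambient gradient onto the row space of the
    Jacobian of a chart, uniqueness from the tangency of both candidates. The relation that
    expresses [phi l] through the first traces holds on [Gamma] only and not between the polynomial
    pieces, so linearity is proved for traces, while continuity and integrability come from the
    pieces. *)

(** * Ranks of congruent matrix pencils *)

Lemma rank_congruence (F : fieldType) (m n : nat) (P : 'M[F]_(m, n))
    (S : 'M[F]_n) :
  row_full P -> \rank (P *m S *m P^T) = \rank S.
Proof.
move=> fP; have fPT : row_free P^T by rewrite /row_free mxrank_tr.
rewrite mxrankMfree// -mxrank_tr trmx_mul mxrankMfree//.
exact: mxrank_tr.
Qed.

Lemma pencil_congruence (F : fieldType) (m n : nat) (P : 'M[F]_(m, n))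
    (A B : 'M[F]_n) (beta : F) : row_full P ->
  \rank (P *m A *m P^T - beta *: (P *m B *m P^T)) = \rank (A - beta *: B)%R.
Proof.
move=> fP; rewrite -(rank_congruence _ fP) mulmxBr mulmxBl.
by rewrite -scalemxAr -scalemxAl.
Qed.

Lemma leq_nrank (F : fieldType) (n : nat) (A B : 'M[F]_n) (beta : F) :
  (\rank (A - beta *: B)%R <= nrank A B)%N.
Proof.
have lt : (\rank (A - beta *: B)%R < n.+1)%N by rewrite ltnS rank_leq_row.
apply: (@leq_bigmax_cond _ _ (fun r : 'I_n.+1 => r : nat) (Ordinal lt)).
by apply/asboolP; exists beta.
Qed.

(** Reduces the comparison of two normal ranks to a comparison of the pencils at each beta. *)
Lemma nrank_leP (F : fieldType) (n d : nat) (A B : 'M[F]_n) :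
  (nrank A B <= d)%N <-> forall beta, (\rank (A - beta *: B)%R <= d)%N.
Proof.
split=> [le beta|le]; first exact: leq_trans (leq_nrank _ _ _) le.
by apply/bigmax_leqP => r /asboolP[beta <-].
Qed.

Lemma nrank_congruence (F : fieldType) (m n : nat) (P : 'M[F]_(m, n))
    (A B : 'M[F]_n) :
  row_full P -> nrank (P *m A *m P^T) (P *m B *m P^T) = nrank A B.
Proof.
move=> fP; apply/eqP; rewrite eqn_leq; apply/andP; split.
  by apply/nrank_leP => beta; rewrite pencil_congruence// leq_nrank.
by apply/nrank_leP => beta; rewrite -(pencil_congruence _ _ _ fP) leq_nrank.
Qed.

Lemma finite_eigenvalue_congruence (F : fieldType) (m n : nat)
    (P : 'M[F]_(m, n)) (A B : 'M[F]_n) (lambda : F) :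
  row_full P ->
  finite_eigenvalue (P *m A *m P^T) (P *m B *m P^T) lambda <->
  finite_eigenvalue A B lambda.
Proof.
by move=> fP; rewrite /finite_eigenvalue pencil_congruence// nrank_congruence.
Qed.

(** * The two-dimensional Hausdorff measure *)

Section Hausdorff.
Variable R : realType.
Local Notation E := 'rV[R]_3.
Implicit Types (A B F : set E) (u v x y : E).

Lemma coord_le_norm n (u : 'rV[R]_n.+1) i : `|u 0 i| <= `|u|.
Proof.
rewrite [leRHS]/Num.Def.normr /= mx_normrE; apply/bigmax_geP; right.
by exists (ord0, i).
Qed.

Lemma norm_leP n (u : 'rV[R]_n.+1) (d : R) : 0 <= d ->
  (forall i, `|u 0 i| <= d) -> `|u| <= d.
Proof.
move=> d0 ud; rewrite [leLHS]/Num.Def.normr /= mx_normrE; apply/bigmax_leP; split => //.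
by case=> i j _ /=; rewrite (ord1 i).
Qed.

Lemma dot_ge0 u : 0 <= dot u u.
Proof. by apply: sumr_ge0 => i _; rewrite -expr2 sqr_ge0. Qed.

Lemma dot_eq0 u : dot u u = 0 -> u = 0.
Proof.
move=> /eqP; rewrite psumr_eq0; last by move=> i _; rewrite -expr2 sqr_ge0.
move=> /allP u0; apply/rowP => i; apply/eqP; rewrite mxE.
by have := u0 i (mem_index_enum _); rewrite /= mulf_eq0 orbb.
Qed.

Lemma enorm_ge0 u : 0 <= enorm u. Proof. exact: sqrtr_ge0. Qed.

Lemma norm_le_enorm u : `|u| <= enorm u.
Proof.
apply: norm_leP => [|i]; first exact: enorm_ge0.
rewrite -sqrtr_sqr ler_sqrt ?dot_ge0// /dot (bigD1 i)//= -expr2 lerDl.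
by apply: sumr_ge0 => j _; rewrite -expr2 sqr_ge0.
Qed.

Lemma norm_dot_le u v : `|dot u v| <= 3 * (`|u| * `|v|).
Proof.
apply: (le_trans (ler_norm_sum _ _ _)).
apply: (@le_trans _ _ (\sum_(i < 3) `|u| * `|v|)).
  by apply: ler_sum => i _; rewrite normrM ler_pM// coord_le_norm.
by rewrite sumr_const card_ord mulr_natl.
Qed.

Lemma enorm_le_norm u : enorm u <= 2 * `|u|.
Proof.
rewrite -[leRHS]ger0_norm ?mulr_ge0// -sqrtr_sqr ler_sqrt ?sqr_ge0//.
apply: (le_trans (ler_norm _)); apply: (le_trans (norm_dot_le _ _)).
by rewrite expr2 mulrACA -natrM ler_wpM2r ?ler_nat.
Qed.

Lemma enormN u : enorm (- u) = enorm u.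
Proof. by rewrite /enorm /dot; congr Num.sqrt; apply: eq_bigr => i _; rewrite !mxE mulrNN. Qed.

Lemma diam_le (C : set E) (d : R) : 0 <= d ->
  (forall x y, C x -> C y -> enorm (x - y) <= d) -> 0 <= diam C <= d.
Proof.
move=> d0 Cd; rewrite /diam.
have ub : ubound [set enorm (p.1 - p.2) | p in C `*` C] d.
  by move=> _ [[x y] [/= Cx Cy] <-]; exact: Cd.
have [->|/set0P[x Cx]] := eqVneq C set0.
  by rewrite set0X image_set0 sup0 lexx d0.
apply/andP; split; last by apply: ge_sup => //; exists (enorm (x - x)), (x, x).
apply: le_trans (enorm_ge0 (x - x)) _; apply: ub_le_sup; first by exists d.
by exists (x, x).
Qed.

Lemma diam_set0 : diam (set0 : set E) = 0.
Proof. by rewrite /diam set0X image_set0 sup0. Qed.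

Lemma weight_ge0 (d : R) : 0 <= pi / 4 * d ^+ 2.
Proof. by rewrite mulr_ge0 ?sqr_ge0// divr_ge0 ?pi_ge0. Qed.

Lemma hausdorff2_delta_finite_cover (delta d : R) A (n : nat)
    (C : nat -> set E) : 0 <= d <= delta ->
  (forall x, A x -> exists2 k, (k < n)%N & C k x) ->
  (forall k x y, C k x -> C k y -> enorm (x - y) <= d) ->
  (hausdorff2_delta delta A <= (n%:R * (pi / 4 * d ^+ 2))%:E)%E.
Proof.
move=> /andP[d0 ddelta] AC Cd.
(* Empty sets have diameter 0, so they extend the finite cover to a sequence at no cost. *)
pose C' k := if (k < n)%N then C k else set0.
apply: (@le_trans _ _ (\sum_(0 <= k <oo) (pi / 4 * diam (C' k) ^+ 2)%:E)%E).
  apply: ereal_inf_lbound; exists C' => //; split.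
    move=> k x y; rewrite /C'; case: ifP => // _ Cx Cy.
    exact: le_trans (Cd _ _ _ Cx Cy) ddelta.
  by move=> x /AC[k kn Ckx]; exists k => //; rewrite /C' kn.
rewrite (nneseries_split 0%N n); last first.
  by move=> k _; rewrite lee_fin weight_ge0.
rewrite add0n [X in (_ + X)%E]eseries0 ?adde0; last first.
  by move=> k nk _; rewrite /C' ltnNge nk /= diam_set0 expr0n/= mulr0.
rewrite sumEFin lee_fin.
apply: (@le_trans _ _ (\sum_(0 <= k < n) pi / 4 * d ^+ 2)); last first.
  by rewrite big_const_nat subn0 iter_addr_0 mulr_natl.
apply: ler_sum_nat => k _; apply: ler_wpM2l; first by rewrite divr_ge0 ?pi_ge0.
have /andP[D0 Dd] : 0 <= diam (C' k) <= d.
  by apply: diam_le => // x y; rewrite /C'; case: ifP => // _; exact: Cd.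
by rewrite ler_sqr ?nnegrE.
Qed.

Lemma hausdorff2_le0 A : (hausdorff2 A <= 0)%E -> hausdorff2 A = 0%E.
Proof.
by move=> A0; apply/eqP; rewrite eq_le A0 (outer_measure_ge0 (@hausdorff2_outer R)).
Qed.

Lemma hausdorff2_subset A B : A `<=` B -> (hausdorff2 A <= hausdorff2 B)%E.
Proof. exact: (le_outer_measure (@hausdorff2_outer R)). Qed.

Lemma hausdorff2_delta_le_hausdorff2 (delta : R) A : 0 < delta ->
  (hausdorff2_delta delta A <= hausdorff2 A)%E.
Proof. by move=> d0; apply: ereal_sup_ubound; exists delta. Qed.

Lemma hausdorff2_null_subset A B : A `<=` B -> hausdorff2 B = 0%E ->
  hausdorff2 A = 0%E.
Proof.
by move=> AB B0; apply: hausdorff2_le0; rewrite -B0; exact: hausdorff2_subset.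
Qed.

Lemma hausdorff2_null_bigcup (C : nat -> set E) :
  (forall k, hausdorff2 (C k) = 0%E) -> hausdorff2 (\bigcup_k C k) = 0%E.
Proof.
move=> C0; apply: hausdorff2_le0.
apply: le_trans (outer_measure_sigma_subadditive (@hausdorff2_outer R) C) _.
by rewrite eseries0// => k _ _; exact: C0.
Qed.

Lemma hausdorff2_null_bigcup_countable (I : choiceType) (D : set I)
    (C : I -> set E) : countable D ->
  (forall i, D i -> hausdorff2 (C i) = 0%E) ->
  hausdorff2 (\bigcup_(i in D) C i) = 0%E.
Proof.
move=> /pfcard_geP[->|/unsquash f] C0.
  by rewrite bigcup_set0 (outer_measure0 (@hausdorff2_outer R)).
apply: (@hausdorff2_null_subset _ (\bigcup_k C (f k))).
  by move=> x [i Di Cix]; have [k _ fk] := @surj _ _ _ _ f _ Di; exists k => //; rewrite fk.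
apply: hausdorff2_null_bigcup => k; apply: C0; exact: funS.
Qed.

Lemma truncn_cell (n : nat) (s t : R) : 0 <= s -> 0 <= t ->
  Num.truncn (n.+1%:R * s) = Num.truncn (n.+1%:R * t) ->
  `|s - t| <= n.+1%:R^-1.
Proof.
move=> s0 t0 st.
have n0 : 0 < n.+1%:R :> R by rewrite ltr0n.
have /truncn_itv/andP[s1 s2] : 0 <= n.+1%:R * s by rewrite mulr_ge0.
have /truncn_itv/andP[t1 t2] : 0 <= n.+1%:R * t by rewrite mulr_ge0.
rewrite -(ler_pM2l n0) divff ?gt_eqF// -[X in X * `|_|]gtr0_norm// -normrM.
rewrite mulrBr ler_norml; move: s1 s2; rewrite st -natr1 => s1 s2.
move: t1 t2; rewrite -natr1 => t1 t2.
by apply/andP; split; lra.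
Qed.

(** The endpoint t = 1 lies in the cell of index n + 1, which makes n + 2 cells of width 1 / (n +
    1). *)
Lemma truncn_cell_lt (n : nat) (t : R) : 0 <= t <= 1 ->
  (Num.truncn (n.+1%:R * t) < n.+2)%N.
Proof.
move=> /andP[t0 t1]; have n0 : 0 < n.+1%:R :> R by rewrite ltr0n.
have /truncn_itv/andP[t2 _] : 0 <= n.+1%:R * t by rewrite mulr_ge0// ltW.
rewrite ltnS -(ler_nat R); apply: le_trans t2 _.
by rewrite ger_pMr.
Qed.

Lemma hausdorff2_le (A : set E) (M : R) :
  (forall delta : R, 0 < delta -> (hausdorff2_delta delta A <= M%:E)%E) ->
  (hausdorff2 A <= M%:E)%E.
Proof. by move=> AM; apply: ge_ereal_sup => _ [d d0 <-]; exact: AM. Qed.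

Lemma archi_le (a b : R) : 0 <= a -> 0 < b -> exists n : nat, a / n.+1%:R <= b.
Proof.
move=> a0 b0; exists (Num.truncn (a / b)).
have /truncn_itv/andP[_ /ltW] : 0 <= a / b by rewrite divr_ge0// ltW.
by rewrite ler_pdivrMr// mulrC ler_pdivrMr ?ltr0n.
Qed.

(** The inverse of t is Lipschitz, so the n + 2 cells of [0, 1] cut Z into pieces of diameter at
    most L / (n + 1); their total weight is of order 1 / n. *)
Lemma hausdorff2_lipschitz_curve (Z : set E) (t : E -> R) (L : R) :
  (forall x, Z x -> 0 <= t x <= 1) ->
  (forall x y, Z x -> Z y -> enorm (x - y) <= L * `|t x - t y|) ->
  hausdorff2 Z = 0%E.
Proof.
move=> Zt ZL; wlog L0 : L ZL / 0 <= L.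
  move=> /(_ `|L|); apply=> // x y Zx Zy; apply: le_trans (ZL _ _ Zx Zy) _.
  by rewrite ler_wpM2r// ler_norm.
apply: hausdorff2_le0; apply: hausdorff2_le => delta delta0.
apply/lee_addgt0Pr => e e0; rewrite add0e.
(* [n1] makes the pieces no larger than delta and [n2] makes their total weight at most e; the
   factor 2 bounds (n + 2) / (n + 1). *)
have [n1 Hn1] := archi_le L0 delta0.
have [n2 Hn2] : exists n2 : nat, (2 * (pi / 4 * L ^+ 2)) / n2.+1%:R <= e.
  by apply: archi_le => //; rewrite mulr_ge0// weight_ge0.
pose n := maxn n1 n2.
have nle m : (m <= n)%N -> n.+1%:R^-1 <= m.+1%:R^-1 :> R.
  by move=> mn; rewrite lef_pV2 ?posrE ?ltr0n// ler_nat.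
pose C k := [set x | Z x /\ Num.truncn (n.+1%:R * t x) = k].
apply: (@le_trans _ _ ((n.+2%:R * (pi / 4 * (L / n.+1%:R) ^+ 2))%:E)%E).
  apply: (@hausdorff2_delta_finite_cover _ _ _ _ C).
  - rewrite divr_ge0//=; apply: le_trans Hn1.
    by apply: ler_wpM2l => //; apply: nle; rewrite leq_maxl.
  - move=> x Zx; exists (Num.truncn (n.+1%:R * t x)) => //.
    exact: truncn_cell_lt (Zt _ Zx).
  - move=> k x y [Zx kx] [Zy ky]; apply: le_trans (ZL _ _ Zx Zy) _.
    rewrite ler_wpM2l//; have /andP[tx _] := Zt _ Zx; have /andP[ty _] := Zt _ Zy.
    by apply: truncn_cell => //; rewrite kx ky.
rewrite lee_fin; apply: (@le_trans _ _ (2 * (pi / 4 * L ^+ 2) / n.+1%:R)).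
  have -> : n.+2%:R * (pi / 4 * (L / n.+1%:R) ^+ 2) =
     (n.+2%:R / n.+1%:R) * (pi / 4 * L ^+ 2) / n.+1%:R :> R.
    by field; rewrite gt_eqF// ltr0n.
  rewrite ler_wpM2r// ler_wpM2r ?weight_ge0// ler_pdivrMr ?ltr0n//.
  by rewrite -natrM ler_nat mul2n -addnn addnS ltnS leq_addr.
apply: le_trans Hn2; apply: ler_wpM2l; first by rewrite mulr_ge0 ?weight_ge0.
by apply: nle; rewrite leq_maxr.
Qed.

(** The unit square has (n + 2)^2 cells, each giving a piece of diameter at most 2 L / (n + 1), so
    the total weight stays bounded as n grows. *)
Lemma hausdorff2_lipschitz_square (Z : set E) (s t : E -> R) (L : R) :
  (forall x, Z x -> 0 <= s x <= 1) -> (forall x, Z x -> 0 <= t x <= 1) ->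
  (forall x y, Z x -> Z y ->
     enorm (x - y) <= L * (`|s x - s y| + `|t x - t y|)) ->
  (hausdorff2 Z < +oo)%E.
Proof.
move=> Zs Zt ZL; wlog L0 : L ZL / 0 <= L.
  move=> /(_ `|L|); apply=> // x y Zx Zy; apply: le_trans (ZL _ _ Zx Zy) _.
  by rewrite ler_wpM2r ?addr_ge0// ler_norm.
(* 16 is the product of 4, from squaring the factor 2 of the diameter, and of the bound 4 on ((n +
   2) / (n + 1))^2. *)
pose M := 16 * (pi / 4 * L ^+ 2).
apply: (@le_lt_trans _ _ M%:E); last exact: ltry.
apply: hausdorff2_le => delta delta0.
have [n Hn] : exists n : nat, (2 * L) / n.+1%:R <= delta.
  by apply: archi_le => //; rewrite mulr_ge0.
(* The pair of cell indices is coded by one number k, as quotient and remainder by n + 2. *)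
pose C k := [set x | [/\ Z x, Num.truncn (n.+1%:R * s x) = (k %/ n.+2)%N &
                             Num.truncn (n.+1%:R * t x) = (k %% n.+2)%N]].
apply: (@le_trans _ _
    (((n.+2 * n.+2)%:R * (pi / 4 * (2 * L / n.+1%:R) ^+ 2))%:E)%E).
  apply: (@hausdorff2_delta_finite_cover _ _ _ _ C).
  - by rewrite Hn divr_ge0// mulr_ge0.
  - move=> x Zx.
    have cs := truncn_cell_lt n (Zs _ Zx); have ct := truncn_cell_lt n (Zt _ Zx).
    exists (Num.truncn (n.+1%:R * s x) * n.+2 + Num.truncn (n.+1%:R * t x))%N.
      by rewrite -ltn_divLR// divnMDl// divn_small// addn0.
    by split => //; [rewrite divnMDl// divn_small// addn0|
                     rewrite modnMDl modn_small].
  - move=> k x y [Zx sx tx] [Zy sy ty]; apply: le_trans (ZL _ _ Zx Zy) _.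
    rewrite (_ : 2 * L / _ = L * (n.+1%:R^-1 + n.+1%:R^-1)); last by ring.
    apply: ler_wpM2l => //.
    have /andP[sx0 _] := Zs _ Zx; have /andP[sy0 _] := Zs _ Zy.
    have /andP[tx0 _] := Zt _ Zx; have /andP[ty0 _] := Zt _ Zy.
    by apply: lerD; apply: truncn_cell; rewrite ?sx ?sy ?tx ?ty.
rewrite lee_fin /M.
have -> : (n.+2 * n.+2)%:R * (pi / 4 * (2 * L / n.+1%:R) ^+ 2) =
   (n.+2%:R / n.+1%:R) ^+ 2 * 4 * (pi / 4 * L ^+ 2) :> R.
  by rewrite natrM; field; rewrite gt_eqF// ltr0n.
rewrite ler_wpM2r ?weight_ge0//.
have : (n.+2%:R / n.+1%:R) ^+ 2 <= 2 ^+ 2 :> R.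
  rewrite ler_sqr ?nnegrE ?divr_ge0// ler_pdivrMr ?ltr0n//.
  by rewrite -natrM ler_nat mul2n -addnn addnS ltnS leq_addr.
by move: (_ ^+ 2) => q; rewrite expr2; lra.
Qed.

(** A Lindelof argument: the balls with rational centre and radius 1 / (n + 1) are countably many,
    and those that meet A in a null set cover A. *)
Lemma hausdorff2_null_local (A : set E) :
  (forall x, A x -> exists2 e : R, 0 < e & hausdorff2 (A `&` ball x e) = 0%E) ->
  hausdorff2 A = 0%E.
Proof.
move=> Aloc.
pose C (i : 'rV[rat]_3 * nat) : set E :=
  A `&` ball (map_mx ratr i.1 : E) i.2.+1%:R^-1.
pose D := [set i | hausdorff2 (C i) = 0%E].
apply: (@hausdorff2_null_subset _ (\bigcup_(i in D) C i)); last first.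
  by apply: hausdorff2_null_bigcup_countable => //; exact: countableP.
move=> x Ax; have [e e0 xe0] := Aloc x Ax.
(* A ball of radius 1 / (n + 1) that contains x lies in the ball of radius 2 / (n + 1) around x. *)
have [n ne] : exists n : nat, 2 / n.+1%:R <= e by exact: archi_le.
have r0 : 0 < n.+1%:R^-1 :> R by rewrite invr_gt0 ltr0n.
have /choice[q xq] : forall i : 'I_3, exists q : rat,
    `|x 0 i - ratr q| < n.+1%:R^-1.
  move=> i; have /rat_in_itvoo[q] : x 0 i < x 0 i + n.+1%:R^-1 by rewrite ltrDl.
  rewrite in_itv/= => /andP[q1 q2]; exists q.
  by rewrite ltr_norml ltrBlDr ltrNl opprB ltrBlDl q2 (lt_trans q1)// ltrDr.
pose c : 'rV[rat]_3 := \row_i q i.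
have cx : ball (map_mx ratr c : E) n.+1%:R^-1 x.
  split=> // i j; rewrite (ord1 i) !mxE /ball/= distrC; exact: xq.
exists (c, n) => //; rewrite /D/=.
apply: hausdorff2_null_subset xe0 => y [Ay cy]; split => //.
rewrite /C/= in cy; apply: (@le_ball _ _ _ (n.+1%:R^-1 + n.+1%:R^-1)).
  by apply: le_trans ne; rewrite mulr_natl mulr2n.
by apply: ball_triangle cy; exact: ball_sym.
Qed.

Lemma hausdorff2_compact_lt_pinfty (K : set E) : compact K ->
  (forall x, K x -> exists2 e : R, 0 < e & (hausdorff2 (K `&` ball x e) < +oo)%E) ->
  (hausdorff2 K < +oo)%E.
Proof.
rewrite compact_cover => cK Kloc.
pose P x := [set e : R | 0 < e /\ (hausdorff2 (K `&` ball x e) < +oo)%E].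
pose r x := xget 1 (P x).
have rP x : K x -> P x (r x).
  by move=> /Kloc[e e0 Ke]; rewrite /r; case: xgetP => [d _ //|/(_ e)[]].
have [D DK KD] : finite_subset_cover K (fun x => ball x (r x)) K.
  apply: cK => [x _|x Kx]; first exact: ball_open.
  by exists x => //; apply: ballxx; exact: (rP _ Kx).1.
have /le_lt_trans : (hausdorff2 K <=
    hausdorff2 (\big[setU/set0]_(x <- D) (K `&` ball x (r x))))%E.
  apply: hausdorff2_subset => y Ky; rewrite -bigcup_fset.
  by have [x Dx xy] := KD _ Ky; exists x.
apply; rewrite big_seq; elim/big_ind: _ => [|A B Afin Bfin|x /DK/set_mem Kx].
- by rewrite (outer_measure0 (@hausdorff2_outer R)).
- apply: le_lt_trans (outer_measureU2 (@hausdorff2_outer R) A B) _.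
  by rewrite lte_add_pinfty.
- exact: (rP _ Kx).2.
Qed.

(** * Additivity over separated sets and measurability of closed sets *)

Lemma hausdorff2_delta_anti A (d1 d2 : R) : d1 <= d2 ->
  (hausdorff2_delta d2 A <= hausdorff2_delta d1 A)%E.
Proof.
move=> d12; apply: ereal_inf_le_tmp => _ [C [Cd AC] <-]; exists C => //.
by split => // k x y Cx Cy; exact: le_trans (Cd k x y Cx Cy) d12.
Qed.

(** A set of diameter at most d cannot meet both A and B, so every cover of the union splits into a
    cover of A and a cover of B. *)
Lemma hausdorff2_delta_separated A B (d : R) :
  (forall x y, A x -> B y -> d < enorm (x - y)) ->
  (hausdorff2_delta d A + hausdorff2_delta d B <=
   hausdorff2_delta d (A `|` B))%E.
Proof.
move=> AB; apply: le_ereal_inf_tmp => _ [C [Cd ABC] <-].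
pose part S k := if `[< C k `&` S !=set0 >] then C k else set0.
have partS S : S `<=` A `|` B -> (hausdorff2_delta d S <=
    \sum_(0 <= k <oo) (pi / 4 * diam (part S k) ^+ 2)%:E)%E.
  move=> SAB; apply: ereal_inf_lbound; exists (part S) => //; split.
    by move=> k x y; rewrite /part; case: ifP => // _; exact: Cd.
  move=> x Sx; have [k _ Ckx] := ABC _ (SAB _ Sx); exists k => //.
  by rewrite /part asboolT//; exists x.
apply: (le_trans (leeD (partS A (@subsetUl _ _ _)) (partS B (@subsetUr _ _ _)))).
rewrite -nneseriesD; last 2 first.
- by move=> k _; rewrite lee_fin weight_ge0.
- by move=> k _; rewrite lee_fin weight_ge0.
apply: lee_nneseries => k _; first by rewrite -EFinD lee_fin addr_ge0 ?weight_ge0.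
rewrite -EFinD lee_fin /part.
have [[x [Cx Ax]]|_] := asboolP (C k `&` A !=set0); last first.
  rewrite diam_set0 expr0n/= mulr0 add0r.
  by case: asboolP => // _; rewrite diam_set0 expr0n/= mulr0 weight_ge0.
rewrite asboolF ?diam_set0 ?expr0n/= ?mulr0 ?addr0// => -[y [Cy By]].
by have := lt_le_trans (AB _ _ Ax By) (Cd _ _ _ Cx Cy); rewrite ltxx.
Qed.

(** The suprema for A and B are taken at independent scales [d1] and [d2]; passing to a common
    smaller scale can only increase both terms. *)
Lemma hausdorff2_metric A B (e : R) : 0 < e ->
  (forall x y, A x -> B y -> e <= enorm (x - y)) ->
  (hausdorff2 A + hausdorff2 B <= hausdorff2 (A `|` B))%E.
Proof.
move=> e0 AB; have [->|ABoo] := eqVneq (hausdorff2 (A `|` B)) +oo%E.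
  exact: leey.
have fin S : S `<=` A `|` B -> hausdorff2 S \is a fin_num.
  move=> SAB; rewrite ge0_fin_numE; last exact: (outer_measure_ge0 (@hausdorff2_outer R)).
  by apply: le_lt_trans (hausdorff2_subset SAB) _; rewrite ltey.
have fA := fin A (@subsetUl _ _ _); have fB := fin B (@subsetUr _ _ _).
rewrite -leeBrDr//; apply: ge_ereal_sup => _ [d1 d10 <-].
rewrite leeBrDr// -leeBrDl; last first.
  rewrite ge0_fin_numE.
    by apply: le_lt_trans (hausdorff2_delta_le_hausdorff2 _ d10) _; rewrite ltey_eq fA.
  apply: le_ereal_inf_tmp => _ [C _ <-].
  by apply: nneseries_ge0 => k _ _; rewrite lee_fin weight_ge0.
apply: ge_ereal_sup => _ [d2 d20 <-].
rewrite leeBrDl; last first.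
  rewrite ge0_fin_numE.
    by apply: le_lt_trans (hausdorff2_delta_le_hausdorff2 _ d10) _; rewrite ltey_eq fA.
  apply: le_ereal_inf_tmp => _ [C _ <-].
  by apply: nneseries_ge0 => k _ _; rewrite lee_fin weight_ge0.
(* At most [d1] and [d2] for monotonicity, strictly below e for separation. *)
pose d := Num.min (Num.min d1 d2) (e / 2).
have d0 : 0 < d by rewrite !lt_min d10 d20 divr_gt0.
apply: (@le_trans _ _ (hausdorff2_delta d A + hausdorff2_delta d B)%E).
  by apply: leeD; apply: hausdorff2_delta_anti; rewrite !ge_min lexx ?orbT.
apply: le_trans (hausdorff2_delta_le_hausdorff2 _ d0).
apply: hausdorff2_delta_separated => x y Ax By; apply: lt_le_trans (AB _ _ Ax By).
by rewrite gt_min; apply/orP; right; rewrite ltr_pdivrMr// ltr_pMr// ltr1n.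
Qed.

(* Caratheodory's criterion: the shells of rho-height between 1/(n+1) and 1/n,
   two apart, are at positive distance, so their measures are summable. *)
Lemma caratheodory_zero_set (rho : E -> R) : (forall x, 0 <= rho x) ->
  (forall x y, rho x <= rho y + enorm (x - y)) ->
  (@hausdorff2 R).-caratheodory [set x | rho x = 0].
Proof.
move=> rho0 rhoL; set F := [set x | rho x = 0].
apply: (@le_caratheodory_measurable _ _ (@hausdorff2_outer R)) => X /=.
have [->|Xoo] := eqVneq (hausdorff2 X) +oo%E; first exact: leey.
have HX_fin : hausdorff2 X \is a fin_num.
  rewrite ge0_fin_numE ?ltey//; exact: (outer_measure_ge0 (@hausdorff2_outer R)).
pose lev x := Num.truncn (rho x)^-1.
pose S k := [set x | [/\ X x, 0 < rho x & lev x = k]].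
have levP x : 0 < rho x -> (lev x)%:R <= (rho x)^-1 < (lev x).+1%:R.
  by move=> x0; apply: truncn_itv; rewrite invr_ge0 ltW.
have lev_gt x n : 0 < rho x -> (lev x <= n)%N -> n.+1%:R^-1 <= rho x.
  move=> x0 xn; have /andP[_ /ltW h] := levP _ x0.
  rewrite -[leRHS]invrK lef_pV2 ?posrE ?invr_gt0 ?ltr0n//.
  by apply: le_trans h _; rewrite ler_nat.
have lev_lt x n : 0 < rho x -> (n < lev x)%N -> rho x <= n.+1%:R^-1.
  move=> x0 xn; have /andP[h _] := levP _ x0.
  rewrite -[leLHS]invrK lef_pV2 ?posrE ?invr_gt0 ?ltr0n//.
  by apply: le_trans h; rewrite ler_nat.
have gap (n : nat) : 0 < n.+1%:R^-1 - n.+2%:R^-1 :> R.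
  by rewrite subr_gt0 ltf_pV2 ?posrE ?ltr0n// ltr_nat.
(* For b = 0, 1 these are the even and the odd levels. Levels of equal parity differ by at least 2,
   so their shells are separated and the measures add up. *)
have sumS b : (\sum_(0 <= k <oo) hausdorff2 (S (k.*2 + b)%N) <= hausdorff2 X)%E.
  have cv : cvg ((\sum_(0 <= k < n) hausdorff2 (S (k.*2 + b)%N))%E @[n --> \oo]).
    apply: is_cvg_nneseries => k _ _.
    exact: (outer_measure_ge0 (@hausdorff2_outer R)).
  apply: (lime_le cv); apply: nearW => n.
  apply: (@le_trans _ _ (hausdorff2
      [set x | [/\ X x, 0 < rho x & exists2 k, (k < n)%N & lev x = (k.*2 + b)%N]])).
    elim: n => [|n IHn].
      by rewrite big_geq//; exact: (outer_measure_ge0 (@hausdorff2_outer R)).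
    rewrite big_nat_recr//=; apply: (le_trans (leeD2r _ IHn)).
    (* The earlier shells have level at most 2 n + b - 2, hence height at least 1 / (2 n + b - 1);
       the new one has height at most 1 / (2 n + b). *)
    apply: (le_trans (@hausdorff2_metric _ _ _ (gap (n.*2 + b).-2) _)).
      move=> x y [_ x0 [k kn xk]] [_ y0 yn].
      have h1 : (n.*2 + b).-2.+1%:R^-1 <= rho x by apply: lev_gt => //; lia.
      have h2 : rho y <= (n.*2 + b).-2.+2%:R^-1 by apply: lev_lt => //; lia.
      by rewrite lerBlDl (le_trans h1)// (le_trans (rhoL x y))// lerD2r.
    apply: hausdorff2_subset => x [[Xx x0 [k kn xk]]|[Xx x0 xn]].
      by split=> //; exists k => //; exact: ltnW.
    by split=> //; exists n.
  by apply: hausdorff2_subset => x [].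
(* Pairing the levels 2 k and 2 k + 1 merges the two parity sums into one convergent series. *)
pose T k := [set x | [/\ X x, 0 < rho x & (lev x)./2 = k]].
have T_ge0 k : (0 <= hausdorff2 (T k))%E.
  exact: (outer_measure_ge0 (@hausdorff2_outer R)).
have sumT : (\sum_(0 <= k <oo) hausdorff2 (T k) < +oo)%E.
  apply: (@le_lt_trans _ _ (hausdorff2 X + hausdorff2 X)%E); last first.
    by rewrite lte_add_pinfty ?ltey.
  apply: le_trans (leeD (sumS 0%N) (sumS 1%N)); rewrite -nneseriesD; last 2 first.
  - by move=> *; exact: (outer_measure_ge0 (@hausdorff2_outer R)).
  - by move=> *; exact: (outer_measure_ge0 (@hausdorff2_outer R)).
  apply: lee_nneseries => // k _.
  apply: le_trans (outer_measureU2 (@hausdorff2_outer R) _ _).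
  apply: hausdorff2_subset => x [Xx x0 xk].
  have [xo|xe] := boolP (odd (lev x)).
    by right; split => //; rewrite -xk -[LHS]odd_double_half xo; lia.
  by left; split => //; rewrite -xk -[LHS]odd_double_half (negbTE xe); lia.
(* The levels below 2 n form a set at positive distance from F; the other shells cost only a tail of
   the series, which tends to 0. *)
have bound n : (hausdorff2 (X `&` F) + hausdorff2 (X `&` ~` F) <=
    hausdorff2 X + \sum_(n <= k <oo) hausdorff2 (T k))%E.
  pose A := [set x | [/\ X x, 0 < rho x & ((lev x)./2 < n)%N]].
  apply: (@le_trans _ _ (hausdorff2 (X `&` F) +
      (hausdorff2 A + \sum_(n <= k <oo) hausdorff2 (T k)))%E).
    rewrite leeD2l// -nneseries_addn//.
    apply: (@le_trans _ _ (hausdorff2 (A `|` \bigcup_k T (k + n)%N))).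
      apply: hausdorff2_subset => x [Xx /eqP xF].
      have x0 : 0 < rho x by rewrite lt_neqAle eq_sym xF rho0.
      have [xn|nx] := ltnP (lev x)./2 n; first by left; split.
      by right; exists ((lev x)./2 - n)%N => //; split => //; rewrite subnK.
    apply: le_trans (outer_measureU2 (@hausdorff2_outer R) _ _) _.
    by rewrite leeD2l//; exact: (outer_measure_sigma_subadditive (@hausdorff2_outer R)).
  rewrite addeA leeD2r//.
  apply: le_trans (@hausdorff2_metric _ _ n.*2.+1%:R^-1 _ _) _.
  - by rewrite invr_gt0 ltr0n.
  - move=> x y [_ xF] [_ y0 yn]; rewrite -enormN opprB.
    have := rhoL y x; rewrite xF add0r; apply: le_trans.
    by apply: lev_gt => //; lia.
  - by apply: hausdorff2_subset => x [[]|[]].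
have cv : (hausdorff2 X + \sum_(n <= k <oo) hausdorff2 (T k) @[n --> \oo]
    --> hausdorff2 X)%E.
  rewrite -[X in _ --> X]adde0; apply: cvgeD; first by rewrite fin_num_adde_defl.
    exact: cvg_cst.
  exact: nneseries_tail_cvg.
rewrite -(cvg_lim _ cv)//; apply: lime_ge; first by apply/cvg_ex; eexists; exact: cv.
exact: nearW.
Qed.

(** The height is the sup-norm distance to F. It is 1-Lipschitz for [enorm] too, since the sup norm
    is bounded by [enorm], and it vanishes exactly on F because F is closed. *)
Lemma caratheodory_closed F : closed F -> (@hausdorff2 R).-caratheodory F.
Proof.
move=> cF; have [->|/set0P[z Fz]] := eqVneq F set0.
  exact: (caratheodory_measurable_set0 (@hausdorff2_outer R)).
pose D x := [set `|x - y| | y in F].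
have D0 x : lbound (D x) 0 by move=> _ [y _ <-].
have hD x : has_lbound (D x) by exists 0.
have nD x : D x !=set0 by exists `|x - z|, z.
pose rho x := inf (D x).
have rho0 x : 0 <= rho x by exact: lb_le_inf.
rewrite (_ : F = [set x | rho x = 0]).
  apply: caratheodory_zero_set => // x y; rewrite -lerBlDr.
  apply: lb_le_inf => // _ [w Fw <-]; rewrite lerBlDr.
  apply: (@le_trans _ _ `|x - w|); first by apply: ge_inf => //; exists w.
  rewrite [leRHS]addrC -(subrKA y) (le_trans (ler_normD _ _))// lerD2r.
  exact: norm_le_enorm.
apply/seteqP; split => x /= => [Fx|x0].
  apply/eqP; rewrite eq_le rho0 andbT; apply: ge_inf => //.
  by exists x => //; rewrite subrr normr0.
apply: contrapT => nFx; have /nbhs_ballP[e /= e0 xe] : nbhs x (~` F).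
  by apply: open_nbhs_nbhs; split => //; exact: closed_openC.
have : 0 < rho x.
  apply: lt_le_trans e0 _; apply: lb_le_inf => // _ [y Fy <-].
  rewrite leNgt; apply/negP => xy.
  by apply: (xe y) => //; rewrite -ball_normE.
by rewrite x0 ltxx.
Qed.

End Hausdorff.

(** * Functions of class C1 *)

Section Calculus.
Variable R : realType.

Definition C1_at (n : nat) (f : 'rV[R]_n.+1 -> R) (x : 'rV[R]_n.+1) :=
  (\forall y \near x, differentiable f y) /\
  forall i, {for x, continuous (fun y => 'D_(delta_mx 0 i) f y)}.

Definition grad (n : nat) (f : 'rV[R]_n.+1 -> R) (x : 'rV[R]_n.+1) : 'rV[R]_n.+1 :=
  \row_i 'D_(delta_mx 0 i) f x.

Lemma C1_at_differentiable n (f : 'rV[R]_n.+1 -> R) x :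
  C1_at f x -> differentiable f x.
Proof. by case=> /nbhs_singleton. Qed.

Lemma derive_grad n (f : 'rV[R]_n.+1 -> R) x v :
  differentiable f x -> 'D_v f x = \sum_i v 0 i * grad f x 0 i.
Proof.
move=> df; rewrite deriveE// {1}[v]row_sum_delta linear_sum.
by apply: eq_bigr => i _; rewrite linearZ /= mxE deriveE.
Qed.

Lemma diff_grad n (f : 'rV[R]_n.+1 -> R) x v :
  differentiable f x -> 'd f x v = (v *m (grad f x)^T) 0 0.
Proof.
move=> df; rewrite -deriveE// derive_grad// mxE.
by apply: eq_bigr => i _; rewrite [in RHS]mxE.
Qed.

Lemma derive_entry (V : normedModType R) m n (M : V -> 'M[R]_(m.+1, n.+1)) x v i j :
  derivable M x v -> 'D_v (fun y => M y i j) x = ('D_v M x) i j.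
Proof. by move=> dM; rewrite derive_mx// mxE. Qed.

Section C1Closure.
Variable n : nat.
Implicit Types (f g : 'rV[R]_n.+1 -> R) (x : 'rV[R]_n.+1).

Lemma C1_cst (c : R) x : C1_at (fun _ : 'rV[R]_n.+1 => c) x.
Proof.
split; first by near=> y; exact: differentiable_cst.
move=> i; rewrite (_ : (fun y => 'D__ _ y) = fun=> 0); first exact: (@cvg_cst _ _ _ (nbhs x)).
by apply/funext => y; exact: derive_cst.
Unshelve. all: by end_near. Qed.

Lemma C1_coord i x : C1_at (fun y : 'rV[R]_n.+1 => y 0 i) x.
Proof.
split; first by near=> y; exact: differentiable_coord.
move=> j; rewrite (_ : 'D__ _ = fun=> (delta_mx 0 j : 'rV[R]_n.+1) 0 i).
  exact: (@cvg_cst _ _ _ (nbhs x)).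
by apply/funext => y; rewrite derive_entry ?derive_id//; exact: derivable_id.
Unshelve. all: by end_near. Qed.

Lemma C1D f g x : C1_at f x -> C1_at g x -> C1_at (fun y => f y + g y) x.
Proof.
move=> [df cf] [dg cg]; split.
  by near=> y; apply: differentiableD; [near: y|near: y].
move=> i; apply: (@cvg_trans _
  ((fun y => 'D_(delta_mx 0 i) f y + 'D_(delta_mx 0 i) g y) @ x)).
  apply: (@near_eq_cvg _ _ (nbhs x)); near=> y.
  by rewrite [RHS]deriveD//; apply: diff_derivable; near: y.
rewrite deriveD; last 2 first.
- by apply: diff_derivable; exact: nbhs_singleton df.
- by apply: diff_derivable; exact: nbhs_singleton dg.
exact: (cvgD (cf i) (cg i)).
Unshelve. all: by end_near. Qed.

Lemma C1M f g x : C1_at f x -> C1_at g x -> C1_at (fun y => f y * g y) x.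
Proof.
move=> Cf Cg; have [df cf] := Cf; have [dg cg] := Cg; split.
  by near=> y; apply: differentiableM; [near: y|near: y].
move=> i; apply: (@cvg_trans _ ((fun y =>
    f y * 'D_(delta_mx 0 i) g y + g y * 'D_(delta_mx 0 i) f y) @ x)).
  apply: (@near_eq_cvg _ _ (nbhs x)); near=> y.
  by rewrite [RHS]deriveM//; apply: diff_derivable; near: y.
rewrite deriveM; last 2 first.
- by apply: diff_derivable; exact: C1_at_differentiable.
- by apply: diff_derivable; exact: C1_at_differentiable.
have fx := differentiable_continuous (C1_at_differentiable Cf).
have gx := differentiable_continuous (C1_at_differentiable Cg).
exact: (cvgD (cvgM fx (cg i)) (cvgM gx (cf i))).
Unshelve. all: by end_near. Qed.

Lemma C1_sum (I : Type) (r : seq I) (P : pred I) (f : I -> 'rV[R]_n.+1 -> R) x :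
  (forall i, P i -> C1_at (f i) x) -> C1_at (fun y => \sum_(i <- r | P i) f i y) x.
Proof.
move=> Cf; elim: r => [|j r IHr].
  have -> : (fun y => \sum_(i <- [::] | P i) f i y) = fun=> 0.
    by apply/funext => y; rewrite big_nil.
  exact: C1_cst.
have -> : (fun y => \sum_(i <- j :: r | P i) f i y) =
    fun y => (if P j then f j y else 0) + \sum_(i <- r | P i) f i y.
  by apply/funext => y; rewrite big_cons; case: ifP => // _; rewrite add0r.
by apply: C1D => //; case: (P j) (Cf j) => [/(_ isT)//|_]; exact: C1_cst.
Qed.

Lemma C1_prod (I : Type) (r : seq I) (f : I -> 'rV[R]_n.+1 -> R) x :
  (forall i, C1_at (f i) x) -> C1_at (fun y => \prod_(i <- r) f i y) x.
Proof.
move=> Cf; elim: r => [|j r IHr].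
  have -> : (fun y => \prod_(i <- [::]) f i y) = fun=> 1.
    by apply/funext => y; rewrite big_nil.
  exact: C1_cst.
have -> : (fun y => \prod_(i <- j :: r) f i y) =
    fun y => f j y * \prod_(i <- r) f i y.
  by apply/funext => y; rewrite big_cons.
exact: C1M.
Qed.

Lemma C1X f k x : C1_at f x -> C1_at (fun y => f y ^+ k) x.
Proof.
move=> Cf; elim: k => [|k IHk]; first exact: C1_cst.
have -> : (fun y => f y ^+ k.+1) = fun y => f y * f y ^+ k.
  by apply/funext => y; rewrite exprS.
exact: C1M.
Qed.

End C1Closure.

Lemma C1_poly n k (f : 'rV[R]_n.+1 -> R) x :
  MPoly.is_poly_fun k f -> C1_at f x.
Proof.
case=> p [_ fp]; rewrite (funext fp).
apply: C1_sum => m _; apply: C1M; first exact: C1_cst.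
by apply: C1_prod => i; apply: C1X; exact: C1_coord.
Qed.

Lemma mean_value_ball n (f : 'rV[R]_n.+1 -> R) (p : 'rV[R]_n.+1) (r : R)
    (q q' : 'rV[R]_n.+1) :
  (forall c, ball p r c -> differentiable f c) -> ball p r q -> ball p r q' ->
  exists2 c, ball p r c & f q - f q' = \sum_i grad f c 0 i * (q 0 i - q' 0 i).
Proof.
move=> df pq pq'; pose c (t : R) := t *: (q - q') + q'.
have pc (t : R) : 0 <= t <= 1 -> ball p r (c t).
  move=> /andP[t0 t1]; move: pq pq'; rewrite -!ball_normE /= => pq pq'.
  rewrite (_ : p - c t = t *: (p - q) + (1 - t) *: (p - q')); last first.
    by apply/rowP => i; rewrite /c !mxE; ring.
  rewrite (le_lt_trans (ler_normD _ _))// !normrZ ger0_norm// ger0_norm ?subr_ge0//.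
  (* At t = 0 the strict inequality comes from q' instead of q. *)
  have [->|tn0] := eqVneq t 0; first by rewrite mul0r add0r subr0 mul1r.
  have h1 : t * `|p - q| < t * r by rewrite ltr_pM2l// lt_neqAle eq_sym tn0.
  have h2 : (1 - t) * `|p - q'| <= (1 - t) * r.
    by apply: ler_wpM2l; [rewrite subr_ge0|exact: ltW].
  by have := ltr_leD h1 h2; rewrite -[ltRHS]mulrDl (addrC t) subrK mul1r.
have dc (t : R) : 0 <= t <= 1 -> is_derive t (1 : R) (f \o c) ('D_(q - q') f (c t)).
  move=> t01; have dfc : derivable f (c t) (q - q').
    by apply: diff_derivable; apply: df; exact: pc.
  have E : (fun h : R => h^-1 *: ((f \o c) (h *: 1 + t) - (f \o c) t)) =
           (fun h : R => h^-1 *: (f (h *: (q - q') + c t) - f (c t))).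
    apply/funext => h /=; congr (_ *: (f _ - _)).
    by rewrite /c [h *: 1]mulr1 scalerDl addrA.
  by apply: DeriveDef; rewrite /derivable /derive E.
have [//| | |t t01] := @MVT_segment R (f \o c) (fun t => 'D_(q - q') f (c t)) 0 1.
- by move=> t /[!in_itv]/= /andP[/ltW t0 /ltW t1]; apply: dc; rewrite t0.
- apply: derivable_within_continuous => t /[!in_itv]/= t01.
  by have [] := dc t t01.
rewrite /= /c scale1r scale0r add0r subrK subr0 mulr1 => ->.
rewrite in_itv/= in t01; exists (c t); first exact: pc.
rewrite derive_grad; last by apply: df; exact: pc.
by apply: eq_bigr => i _; rewrite !mxE mulrC.
Qed.

End Calculus.

Lemma diff_near (R : realType) (V W : normedModType R) (f : V -> W) (x : V) :
  differentiable f x -> forall e : R, 0 < e ->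
  \forall y \near x, `|f y - f x - 'd f x (y - x)| <= e * `|y - x|.
Proof.
move=> /diff_locally/eqaddoE E e e0.
have h := (eqaddoP _ _ _ _).1 E _ e0.
apply/nbhs0P; near=> h0; rewrite (addrC x) addrK.
have -> : f (h0 + x) - f x - 'd f x h0 = (f \o shift x - (cst (f x) + 'd f x)) h0.
  by rewrite !fctE /= opprD addrA.
by near: h0.
Unshelve. all: by end_near. Qed.

(** * Surface gradients in charts *)

Section Surface.
Variable R : realType.
Local Notation E := 'rV[R]_3.
Local Notation P := 'rV[R]_2.
Implicit Types (Gamma : set E) (X : P -> E) (Y : E -> P) (x y : E).

(** Vectors are rows, so the Jacobian is 2 x 3 and [row_free] says that the differential is
    injective. Everything is stated at the point x, so that one pair X, Y can serve all points of
    [Gamma] near a given one; continuity of surface gradients compares such points. *)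
Definition chart_at Gamma X Y x := [/\ X (Y x) = x,
  (\forall q \near Y x, Gamma (X q)) /\
    (\forall y \near within Gamma (nbhs x), X (Y y) = y),
  Y y @[y --> within Gamma (nbhs x)] --> Y x,
  (\forall q \near Y x, differentiable X q) /\
    forall j, C1_at (fun q => X q 0 j) (Y x) &
  row_free (jacobian X (Y x))].

Lemma differentiable_entry n (f : 'rV[R]_n.+1 -> E) q j :
  differentiable f q -> differentiable (fun q' => f q' 0 j) q.
Proof.
move=> df; apply: (@differentiable_comp _ _ _ _ f (fun v : E => v 0 j)) => //.
exact: differentiable_coord.
Qed.

Lemma jacobianE X q i j : differentiable X q ->
  jacobian X q i j = 'D_(delta_mx 0 i) X q 0 j.
Proof. by move=> dX; rewrite deriveEjacobian// -rowE [RHS]mxE. Qed.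

Lemma jacobian_grad X q i j : differentiable X q ->
  jacobian X q i j = grad (fun q' => X q' 0 j) q 0 i.
Proof.
move=> dX; rewrite jacobianE// mxE derive_entry//.
exact: diff_derivable.
Qed.

Lemma smooth_on_C1_at (U : set P) X q j : open U -> smooth_on U X -> U q ->
  C1_at (fun q => X q 0 j) q.
Proof.
move=> oU sX Uq; split.
  near=> q'; apply: differentiable_entry; apply: (sX [::]); near: q'.
  exact: open_nbhs_nbhs.
move=> i.
apply: (@cvg_trans _ ((fun q' => ('D_(delta_mx 0 i) X q') 0 j) @ q)).
  apply: (@near_eq_cvg _ _ (nbhs q)); near=> q'; rewrite derive_entry//.
  apply: diff_derivable; apply: (sX [::]); near: q'; exact: open_nbhs_nbhs.
rewrite derive_entry; last by apply: diff_derivable; exact: (sX [::]).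
apply: (@differentiable_continuous _ _ _ q (fun q' => 'D_(delta_mx 0 i) X q' 0 j)).
by apply: differentiable_entry; exact: (sX [:: i]).
Unshelve. all: by end_near. Qed.

Lemma row_free_jacobian X q : injective ('d X q) -> row_free (jacobian X q).
Proof.
move=> inj; rewrite -kermx_eq0; apply/rowV0P => v /sub_kermxP vJ.
by apply: inj; rewrite -mul_rV_lin1 linear0.
Qed.

Lemma surface_charts Gamma x : closed_smooth_surface Gamma -> Gamma x ->
  exists X Y, \forall y \near within Gamma (nbhs x), chart_at Gamma X Y y.
Proof.
move=> [_ /[apply]] [V [U [X [oV Vx [oU XU sX [Y YX cY] injX]]]]].
exists X, Y; have VGX y : V y -> Gamma y -> exists2 q, U q & X q = y.
  by move=> Vy Gy; have : (V `&` Gamma) y by []; rewrite -XU => -[q]; exists q.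
rewrite near_withinE; near=> y => Gy; have Vy : V y by near: y; exact: open_nbhs_nbhs.
have [q Uq qy] := VGX _ Vy Gy.
have Yy : Y y = q by rewrite -qy YX.
have nV : \forall z \near within Gamma (nbhs y), V z.
  by apply: cvg_within; exact: open_nbhs_nbhs.
split; rewrite ?Yy//.
- split.
    near=> q'; have : (X @` U) (X q').
      by exists q' => //; near: q'; exact: open_nbhs_nbhs.
    by rewrite XU => -[].
  near=> z; have Vz : V z by near: z.
  have [q' Uq' <-] : exists2 q, U q & X q = z.
    apply: VGX => //; near: z; exact: withinT.
  by rewrite YX.
- have : Y z @[z --> within (V `&` Gamma) (nbhs y)] --> Y y.
    by move/subspace_continuousP : cY; apply.
  rewrite Yy; apply: cvg_trans; apply: cvg_app => A /=.
  move=> VGA; have {}VGA : \forall z \near within Gamma (nbhs y),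
      (V `&` Gamma) z -> A z by apply: cvg_within; exact: VGA.
  suff : \forall z \near within Gamma (nbhs y), A z by [].
  near=> z; apply: (near VGA z) => //; split; near: z => //; exact: withinT.
- split.
    near=> q'; apply: (sX [::]); near: q'; exact: open_nbhs_nbhs.
  by move=> j; exact: smooth_on_C1_at oU sX Uq.
- by apply: row_free_jacobian; exact: injX.
Unshelve. all: by end_near. Qed.

Lemma mulmx_bounded n m (M : 'M[R]_(n.+1, m.+1)) :
  exists2 C, 0 < C & forall u : 'rV[R]_n.+1, `|u *m M| <= C * `|u|.
Proof.
exists (1 + \sum_i \sum_j `|M i j|) => [|u].
  by rewrite ltr_pwDl// sumr_ge0// => i _; rewrite sumr_ge0.
apply: norm_leP => [|j].
  by rewrite mulr_ge0// addr_ge0// sumr_ge0// => i _; rewrite sumr_ge0.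
rewrite mxE (le_trans (ler_norm_sum _ _ _))// mulrDl mul1r ler_wpDl//.
rewrite mulr_suml; apply: ler_sum => i _; rewrite normrM mulrC.
rewrite ler_pM ?coord_le_norm// (bigD1 j)//= lerDl.
by rewrite sumr_ge0.
Qed.

Lemma dotE (u v : E) : dot u v = (u *m v^T) 0 0.
Proof. by rewrite mxE; apply: eq_bigr => i _; rewrite !mxE. Qed.

(** The curve is the image under X of the line through [Y x] with direction w. *)
Lemma chart_tangent Gamma X Y x w : chart_at Gamma X Y x ->
  tangent Gamma x (w *m jacobian X (Y x)).
Proof.
move=> [XY [GX _] _ [/nbhs_singleton dX _] _]; exists (fun t => X (t *: w + Y x)); split.
- by rewrite scale0r add0r.
- have cw : (t *: w + Y x) @[t --> (0 : R)] --> Y x.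
    have : (t *: w + Y x) @[t --> (0 : R)] --> 0 *: w + Y x.
      by apply: cvgD; [apply: cvgZr_tmp; exact: cvg_id|exact: cvg_cst].
    by rewrite scale0r add0r.
  exact: cw GX.
- rewrite -deriveEjacobian//; apply: DeriveDef.
    by apply: (derivable1P X (Y x) w).1; exact: diff_derivable.
  rewrite /derive; set g1 := (X in lim (X @ _)).
  set g2 := (X in _ = lim (X @ _)).
  suff -> : g1 = g2 by []; rewrite /g1 /g2; apply/funext => h /=.
  by rewrite addr0 scale0r add0r [h *: 1]mulr1.
Qed.

(** A column killed by the Jacobian is normal to [Gamma], and y - x is tangent up to a remainder
    small against [Y y - Y x]. As Y is only known to be continuous, a right inverse L of the
    Jacobian is used to bound [Y y - Y x] by y - x. *)
Lemma chart_normal Gamma X Y x (B : 'M[R]_(3, 1)) : chart_at Gamma X Y x ->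
  jacobian X (Y x) *m B = 0 -> forall e, 0 < e ->
  \forall y \near within Gamma (nbhs x), `|((y - x) *m B) 0 0| <= e * `|y - x|.
Proof.
move=> [XY [_ XYy] cY [/nbhs_singleton dX _] /row_freeP[L JL]] JB e e0.
set J := jacobian X (Y x) in JL JB.
have [CL CL0 HL] := mulmx_bounded L; have [CB CB0 HB] := mulmx_bounded B.
(* The first bound gives [CL * d <= 1/2], which absorbs the remainder in the estimate of w; the
   second gives the final factor e. *)
pose d := Num.min (2 * CL)^-1 (e / (2 * CL * CB)).
have d0 : 0 < d.
  by rewrite lt_min invr_gt0 mulr_gt0//= divr_gt0// !mulr_gt0.
have nX := cY _ (diff_near dX d0).
near=> y.
have Xy : X (Y y) = y by near: y.
have : `|X (Y y) - X (Y x) - 'd X (Y x) (Y y - Y x)| <= d * `|Y y - Y x|.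
  by near: y.
have -> : 'd X (Y x) (Y y - Y x) = (Y y - Y x) *m J.
  by rewrite /J /jacobian mul_rV_lin1.
rewrite Xy XY.
set w := Y y - Y x; set r := y - x - w *m J => rd.
have yx : y - x = r + w *m J by rewrite subrK.
have w_le : `|w| <= 2 * CL * `|y - x|.
  have this : w = (y - x) *m L - r *m L.
    by rewrite yx mulmxDl -[w *m J *m L]mulmxA JL mulmx1 addrC addKr.
  have CLd : CL * d <= 2^-1.
    apply: (@le_trans _ _ (CL * (2 * CL)^-1)).
      by rewrite ler_pM2l// ge_min lexx.
    by rewrite invfM mulrC -mulrA mulVf ?gt_eqF// mulr1.
  have h1 : `|w| <= CL * `|y - x| + 2^-1 * `|w|.
    rewrite this (le_trans (ler_normB _ _))// lerD ?HL// -this.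
    rewrite (le_trans (HL _))// (le_trans (ler_wpM2l (ltW CL0) rd))//.
    by rewrite mulrA ler_wpM2r.
  by lra.
rewrite yx mulmxDl -mulmxA JB mulmx0 addr0 -yx.
apply: le_trans (coord_le_norm _ _) _; apply: le_trans (HB _) _.
have CBd : CB * d * (2 * CL) <= e.
  rewrite mulrAC -ler_pdivlMl ?mulr_gt0// mulrC [CB * _]mulrC.
  by rewrite ge_min lexx orbT.
rewrite (le_trans (ler_wpM2l (ltW CB0) rd))//.
rewrite (le_trans _ (ler_wpM2r (normr_ge0 _) CBd))// -!mulrA.
by rewrite ler_pM2l// ler_pM2l// mulrA.
Unshelve. all: by end_near. Qed.

Lemma dotC (u v : E) : dot u v = dot v u.
Proof. by apply: eq_bigr => i _; rewrite mulrC. Qed.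

Lemma dotBl (u v w : E) : dot (u - v) w = dot u w - dot v w.
Proof. by rewrite !dotE mulmxBl !mxE. Qed.

Lemma dotZl (c : R) (u w : E) : dot (c *: u) w = c * dot u w.
Proof. by rewrite !dotE -scalemxAl mxE. Qed.

Lemma dot_suml (I : finType) (u : I -> E) (w : E) :
  dot (\sum_i u i) w = \sum_i dot (u i) w.
Proof. by rewrite dotE mulmx_suml summxE; apply: eq_bigr => i _; rewrite dotE. Qed.

Lemma dot_sumr (I : finType) (u : I -> E) (w : E) :
  dot w (\sum_i u i) = \sum_i dot w (u i).
Proof. by rewrite dotC dot_suml; apply: eq_bigr => i _; rewrite dotC. Qed.

Lemma eq0_by_eps (a K : R) :
  (forall e : R, 0 < e -> e <= 1 -> `|a| <= e * K) -> a = 0.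
Proof.
move=> aK; apply/eqP; rewrite -normr_le0; apply/ler_addgt0Pr => e e0; rewrite add0r.
pose K' := `|K| + 1; have K0 : 0 < K' by rewrite ltr_pwDr.
pose d := Num.min 1 (e / K').
have d0 : 0 < d by rewrite lt_min ltr01 divr_gt0.
apply: (le_trans (aK d d0 _)); first by rewrite ge_min lexx.
apply: (@le_trans _ _ (d * K')).
  by rewrite ler_pM2l// (le_trans (ler_norm _))// lerDl.
by rewrite -ler_pdivlMr// ge_min lexx orbT.
Qed.

(** Along a curve with velocity t, the two first-order expansions of u must agree. *)
Lemma surface_gradient_dot_tangent Gamma (u : E -> R) x g1 g2 t :
  is_surface_gradient Gamma u x g1 -> is_surface_gradient Gamma u x g2 ->
  tangent Gamma x t -> dot (g1 - g2) t = 0.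
Proof.
move=> [_ ug1] [_ ug2] [c [cx Gc dc]]; set D := g1 - g2.
(* The two gradient estimates give 4 e times the sup norm of c s - x, which is at most (|t| + 1) |s|
   as e <= 1; the remainder of c gives 3 |D| e |s| through [norm_dot_le]. *)
apply: (@eq0_by_eps _ (4 * (`|t| + 1) + 3 * `|D|)) => e e0 e1.
have dfc : differentiable c 0 by apply/derivable1_diffP; case: dc.
have cc : c s @[s --> (0 : R)] --> x.
  by rewrite -[X in _ --> X]cx; exact: differentiable_continuous.
have n1 := ug1 _ e0; have n2 := ug2 _ e0.
have n3 := diff_near dfc e0.
rewrite !near_withinE in n1 n2; have {}n1 := cc _ n1; have {}n2 := cc _ n2.
near (0 : R)^' => s.
have s0 : 0 < `|s| by rewrite normr_gt0; near: s; exact: nbhs_dnbhs_neq.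
have Gcs : Gamma (c s) by near: s; exact: nbhs_dnbhs.
have h1 : `|u (c s) - u x - dot g1 (c s - x)| <= e * enorm (c s - x).
  by move: Gcs; near: s; exact: nbhs_dnbhs.
have h2 : `|u (c s) - u x - dot g2 (c s - x)| <= e * enorm (c s - x).
  by move: Gcs; near: s; exact: nbhs_dnbhs.
have : `|c s - c 0 - 'd c 0 (s - 0)| <= e * `|s - 0|.
  by near: s; exact: nbhs_dnbhs.
rewrite cx subr0 deriv1E; last by case: dc.
rewrite derive1E; have -> : 'D_1 c 0 = t by case: dc.
move=> h3.
set r := c s - x - s *: t in h3.
have hc : `|c s - x| <= (`|t| + 1) * `|s|.
  have -> : c s - x = r + s *: t by rewrite subrK.
  rewrite (le_trans (ler_normD _ _))// normrZ mulrDl mul1r [leLHS]addrC.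
  by rewrite lerD// ?(le_trans h3)// ?ger_pMl// mulrC.
have hD : `|dot D (c s - x)| <= 4 * e * `|c s - x|.
  rewrite dotBl (_ : _ - _ = (u (c s) - u x - dot g2 (c s - x)) -
      (u (c s) - u x - dot g1 (c s - x))); last by ring.
  rewrite (le_trans (ler_normB _ _))// (le_trans (lerD h2 h1))//.
  have := ler_wpM2l (ltW e0) (enorm_le_norm (c s - x)); lra.
rewrite -(ler_pM2r s0) -normrM.
have -> : dot D t * s = dot D (c s - x) - dot D r.
  by rewrite !(dotC D) -dotBl /r opprB addrC subrK dotZl mulrC.
rewrite (le_trans (ler_normB _ _))//.
have e4 : 0 <= 4 * e by rewrite mulr_ge0// ltW.
have := le_trans hD (ler_wpM2l e4 hc).
have := le_trans (norm_dot_le D r) (ler_wpM2l _ (ler_wpM2l (normr_ge0 D) h3)).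
move=> /(_ (ler0n _ _)); lra.
Unshelve. all: by end_near. Qed.

(** Each of two gradients is tangent, so their difference is orthogonal to both and hence to itself;
    this avoids any appeal to linearity of the set of tangent vectors. *)
Lemma surface_gradientE Gamma (u : E -> R) x g :
  is_surface_gradient Gamma u x g -> surface_gradient Gamma u x = g.
Proof.
move=> ug; rewrite /surface_gradient; case: xgetP => [g' _ ug'|/(_ g)//].
apply/eqP; rewrite -subr_eq0; apply/eqP/dot_eq0.
have d1 := surface_gradient_dot_tangent ug' ug ug'.1.
have d2 := surface_gradient_dot_tangent ug' ug ug.1.
by rewrite dotBl (dotC g') (dotC g) d1 d2 subrr.
Qed.

Lemma near_is_surface_gradient Gamma (u v : E -> R) x g : u x = v x ->
  (\forall y \near within Gamma (nbhs x), u y = v y) ->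
  is_surface_gradient Gamma u x g -> is_surface_gradient Gamma v x g.
Proof.
move=> uvx uv [tg ug]; split=> // e e0; near=> y.
have <- : u y = v y by near: y.
by rewrite -uvx; near: y; exact: ug.
Unshelve. all: by end_near. Qed.

(** Tangency of the combination is a hypothesis because curves on [Gamma] cannot be added without a
    chart. *)
Lemma is_surface_gradient_sum Gamma (I : finType) (c : I -> R)
    (u : I -> E -> R) x (g : I -> E) :
  (forall i, is_surface_gradient Gamma (u i) x (g i)) ->
  tangent Gamma x (\sum_i c i *: g i) ->
  is_surface_gradient Gamma (fun y => \sum_i c i * u i y) x (\sum_i c i *: g i).
Proof.
move=> ug tg; split=> // e e0.
pose K := 1 + \sum_i `|c i|; have K0 : 0 < K.
  by rewrite ltr_pwDl// sumr_ge0.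
have near_all : \forall y \near within Gamma (nbhs x), forall i,
    `|u i y - u i x - dot (g i) (y - x)| <= e / K * enorm (y - x).
  by apply: filter_forall => i; apply: (ug i).2; exact: divr_gt0.
near=> y; have hy : forall i,
    `|u i y - u i x - dot (g i) (y - x)| <= e / K * enorm (y - x) by near: y.
rewrite dot_suml -!sumrB.
apply: (@le_trans _ _ (\sum_i `|c i| * (e / K * enorm (y - x)))).
  rewrite (le_trans (ler_norm_sum _ _ _))//; apply: ler_sum => i _.
  by rewrite dotZl -!mulrBr normrM ler_wpM2l.
rewrite -mulr_suml mulrA ler_wpM2r ?enorm_ge0// mulrCA ger_pMr//.
by rewrite ler_pdivrMr// mul1r lerDr.
Unshelve. all: by end_near. Qed.

(** For J of full rank, the orthogonal projection of d onto the row space of J, which is the tangent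
    plane if J is the Jacobian of a chart; J J^T is the first fundamental form. *)
Definition tangent_proj (J : 'M[R]_(2, 3)) (d : E) : E :=
  d *m J^T *m invmx (J *m J^T) *m J.

Lemma gram_unit (J : 'M[R]_(2, 3)) : row_free J -> J *m J^T \in unitmx.
Proof.
move=> fJ; rewrite -row_free_unit -kermx_eq0; apply/rowV0P => v /sub_kermxP vJJ.
suff : v *m J = 0 by rewrite -(mul0mx _ J) => /(row_free_inj fJ).
by apply: dot_eq0; rewrite dotE trmx_mul mulmxA -(mulmxA v) vJJ mul0mx mxE.
Qed.

(** What the projection removes from [grad u x] is normal, so by [chart_normal] it is negligible
    along [Gamma]; it takes one half of e and the differentiability of u the other. *)
Lemma chart_gradient Gamma X Y x (u : E -> R) : chart_at Gamma X Y x ->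
  differentiable u x ->
  is_surface_gradient Gamma u x (tangent_proj (jacobian X (Y x)) (grad u x)).
Proof.
move=> ch du; split; first exact: chart_tangent ch.
have [_ _ _ _ fJ] := ch; set J := jacobian X (Y x) in fJ *.
set d := grad u x; move=> e e0.
pose B : 'M[R]_(3, 1) := (d - tangent_proj J d)^T.
have JB : J *m B = 0.
  rewrite /B linearB/= mulmxBr /tangent_proj !trmx_mul trmxK trmx_inv.
  by rewrite !mulmxA trmx_mul trmxK mulmxV ?gram_unit// mul1mx subrr.
have e2 : 0 < e / 2 by rewrite divr_gt0.
have n1 := chart_normal ch JB e2.
have n0 := diff_near du e2.
have n2 : \forall y \near within Gamma (nbhs x),
    `|u y - u x - 'd u x (y - x)| <= e / 2 * `|y - x|.
  by apply: cvg_within; exact: n0.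
near=> y; have h1 : `|((y - x) *m B) 0 0| <= e / 2 * `|y - x| by near: y.
have : `|u y - u x - 'd u x (y - x)| <= e / 2 * `|y - x| by near: y.
rewrite diff_grad// -/d -dotE => h2.
have {}h1 : `|dot d (y - x) - dot (tangent_proj J d) (y - x)| <= e / 2 * `|y - x|.
  by rewrite -dotBl dotC dotE.
rewrite dotC in h2.
have -> : u y - u x - dot (tangent_proj J d) (y - x) =
  (u y - u x - dot d (y - x)) + (dot d (y - x) - dot (tangent_proj J d) (y - x)).
  by rewrite addrA subrK.
rewrite (le_trans (ler_normD _ _))// (le_trans (lerD h2 h1))//.
by rewrite -mulrDl -splitr ler_wpM2l ?norm_le_enorm// ltW.
Unshelve. all: by end_near. Qed.

Lemma surface_gradient_proj Gamma X Y x (u : E -> R) : chart_at Gamma X Y x ->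
  differentiable u x ->
  surface_gradient Gamma u x = tangent_proj (jacobian X (Y x)) (grad u x).
Proof. by move=> ch du; apply: surface_gradientE; exact: chart_gradient. Qed.

(** One factor J J^T cancels an inverse: what remains is the inverse metric paired with the chart
    derivatives [d *m J^T] and [d' *m J^T]. *)
Lemma dot_tangent_proj (J : 'M[R]_(2, 3)) (d d' : E) : row_free J ->
  dot (tangent_proj J d) (tangent_proj J d') =
  (d *m J^T *m invmx (J *m J^T) *m (d' *m J^T)^T) 0 0.
Proof.
move=> fJ; rewrite dotE {2}/tangent_proj trmx_mul [(_ *m invmx _)^T]trmx_mul.
rewrite trmx_inv trmx_mul trmxK !mulmxA.
by rewrite /tangent_proj -[_ *m J *m J^T]mulmxA mulmxK ?gram_unit.
Qed.

Lemma tangent_proj_eq0 (J : 'M[R]_(2, 3)) (d : E) :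
  d *m J^T = 0 -> tangent_proj J d = 0.
Proof. by move=> dJ; rewrite /tangent_proj dJ !mul0mx. Qed.

End Surface.

(** * Limits of matrix expressions, entry by entry *)

Section EntrywiseConvergence.
Variables (R : realType) (T : Type) (F : set_system T).
Context {FF : Filter F}.

Definition cvg_entries m n (M : T -> 'M[R]_(m, n)) (M0 : 'M[R]_(m, n)) :=
  forall i j, M y i j @[y --> F] --> M0 i j.

Lemma cvg_sumr (I : Type) (r : seq I) (f : I -> T -> R) (l : I -> R) :
  (forall i, f i y @[y --> F] --> l i) ->
  \sum_(i <- r) f i y @[y --> F] --> \sum_(i <- r) l i.
Proof. by move=> fl; apply: cvg_big => //; exact: add_continuous. Qed.

Lemma cvg_prodr (I : Type) (r : seq I) (f : I -> T -> R) (l : I -> R) :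
  (forall i, f i y @[y --> F] --> l i) ->
  \prod_(i <- r) f i y @[y --> F] --> \prod_(i <- r) l i.
Proof. by move=> fl; apply: cvg_big => //; exact: mul_continuous. Qed.

Lemma cvg_mulmx m n p (A : T -> 'M[R]_(m, n)) (B : T -> 'M[R]_(n, p)) A0 B0 :
  cvg_entries A A0 -> cvg_entries B B0 ->
  cvg_entries (fun y => A y *m B y) (A0 *m B0).
Proof.
move=> hA hB i j; rewrite mxE; under eq_fun do rewrite mxE.
by apply: cvg_sumr => k; apply: cvgM; [exact: hA|exact: hB].
Qed.

Lemma cvg_trmx m n (A : T -> 'M[R]_(m, n)) A0 :
  cvg_entries A A0 -> cvg_entries (fun y => (A y)^T) A0^T.
Proof. by move=> hA i j; rewrite mxE; under eq_fun do rewrite mxE; exact: hA. Qed.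

Lemma cvg_det n (A : T -> 'M[R]_n) A0 : cvg_entries A A0 ->
  \det (A y) @[y --> F] --> \det A0.
Proof.
move=> hA; apply: cvg_sumr => s; apply: cvgMr.
by apply: cvg_prodr => i; exact: hA.
Qed.

Lemma cvg_adjugate n (A : T -> 'M[R]_n) A0 : cvg_entries A A0 ->
  cvg_entries (fun y => \adj (A y)) (\adj A0).
Proof.
move=> hA i j; rewrite mxE; under eq_fun do rewrite mxE.
apply: cvgMr; apply: cvg_det => k l; rewrite !mxE; under eq_fun do rewrite !mxE.
exact: hA.
Qed.

(** [invmx] is defined by cases, but near the limit the determinant stays nonzero and the adjugate
    formula applies. *)
Lemma cvg_invmx n (A : T -> 'M[R]_n) A0 : A0 \in unitmx -> cvg_entries A A0 ->
  cvg_entries (fun y => invmx (A y)) (invmx A0).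
Proof.
move=> uA hA i j; have d0 : \det A0 != 0 by rewrite -unitfE -unitmxE.
have hd := cvg_det hA.
apply: (@cvg_trans _ ((fun y => (\det (A y))^-1 * (\adj (A y)) i j) @ F)).
  apply: near_eq_cvg; near=> y; rewrite /invmx unitmxE unitfE ifT ?mxE//.
  by near: y; exact: (cvgr_neq0 _ hd d0).
rewrite /invmx uA mxE; apply: cvgM; first exact: cvgV.
exact: cvg_adjugate.
Unshelve. all: by end_near. Qed.

End EntrywiseConvergence.

(** * Continuity of surface gradients, finite area and null zero sets *)

Section Surface.
Variable R : realType.
Local Notation E := 'rV[R]_3.
Local Notation P := 'rV[R]_2.
Implicit Types (Gamma : set E) (X : P -> E) (Y : E -> P) (x y : E).

(** A single chart valid around x turns the pointwise choices of gradients into the formula [H],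
    whose ingredients vary continuously with y. *)
Lemma continuous_dot_surface_gradient Gamma (f g : E -> R) :
  closed_smooth_surface Gamma ->
  (forall x, C1_at f x) -> (forall x, C1_at g x) ->
  {within Gamma, continuous (fun x => dot (surface_gradient Gamma f x)
                                         (surface_gradient Gamma g x))}.
Proof.
move=> sG Cf Cg; apply/subspace_continuousP => x Gx.
have [X [Y ch]] := surface_charts sG Gx.
have chx : chart_at Gamma X Y x.
  by rewrite near_withinE in ch; exact: nbhs_singleton ch Gx.
have [_ _ cY [/nbhs_singleton dX CX] fJ] := chx.
pose J y := jacobian X (Y y).
pose H y := (grad f y *m (J y)^T *m invmx (J y *m (J y)^T) *m
             (grad g y *m (J y)^T)^T) 0 0.
have hE y : chart_at Gamma X Y y -> dot (surface_gradient Gamma f y)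
    (surface_gradient Gamma g y) = H y.
  move=> chy; rewrite !(surface_gradient_proj chy); last 2 first.
  - exact: C1_at_differentiable.
  - exact: C1_at_differentiable.
  by apply: dot_tangent_proj; have [_ _ _ _] := chy.
suff : dot (surface_gradient Gamma f y) (surface_gradient Gamma g y)
    @[y --> within Gamma (nbhs x)] --> H x by rewrite -(hE _ chx).
apply: (@cvg_trans _ (H @ within Gamma (nbhs x))).
  by apply: near_eq_cvg; near=> y; apply/esym/hE; near: y.
have cJ : cvg_entries (within Gamma (nbhs x)) J (J x).
  move=> i j; apply: (@cvg_trans _
      ((fun y => grad (fun q => X q 0 j) (Y y) 0 i) @ within Gamma (nbhs x))).
    apply: near_eq_cvg; near=> y; rewrite -jacobian_grad//.
    by have [_ _ _ [/nbhs_singleton//]] : chart_at Gamma X Y y by near: y.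
  rewrite /J jacobian_grad// mxE; under eq_fun do rewrite mxE.
  exact: (cvg_comp _ _ cY ((CX j).2 i)).
have cgrad (u : E -> R) : C1_at u x ->
    cvg_entries (within Gamma (nbhs x)) (grad u) (grad u x).
  move=> [_ cu] i j; rewrite mxE; under eq_fun do rewrite mxE.
  by apply: cvg_within_filter; exact: (cu j).
have cJT := cvg_trmx cJ.
apply: cvg_mulmx.
  apply: cvg_mulmx; first by apply: cvg_mulmx => //; exact: cgrad.
  by apply: cvg_invmx; [exact: gram_unit|exact: cvg_mulmx].
by apply: cvg_trmx; apply: cvg_mulmx => //; exact: cgrad.
Unshelve. all: by end_near. Qed.

Lemma grad_comp X q (f : E -> R) : differentiable X q -> differentiable f (X q) ->
  grad (f \o X) q = grad f (X q) *m (jacobian X q)^T.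
Proof.
move=> dX df; apply/rowP => i.
have dXi : 'd X q (delta_mx 0 i) = row i (jacobian X q).
  by rewrite -deriveE// deriveEjacobian// -rowE.
rewrite [LHS]mxE deriveE; last exact: differentiable_comp.
rewrite diff_comp//= diff_grad// dXi mxE [RHS]mxE.
by apply: eq_bigr => j _; rewrite [row _ _ _ _]mxE [_^T j 0]mxE [_^T j i]mxE mulrC.
Qed.

Lemma C1_comp X q (f : E -> R) : (\forall q' \near q, differentiable X q') ->
  (forall j, C1_at (fun q => X q 0 j) q) -> (forall x, C1_at f x) ->
  C1_at (f \o X) q.
Proof.
move=> dX CX Cf; have df x := C1_at_differentiable (Cf x).
split.
  near=> q'; apply: differentiable_comp => //; near: q'; exact: dX.
move=> i; have dXq := nbhs_singleton dX.
have E1 q' : differentiable X q' -> 'D_(delta_mx 0 i) (f \o X) q' =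
    \sum_j grad f (X q') 0 j * grad (fun q => X q 0 j) q' 0 i.
  move=> dXq'; have := grad_comp dXq' (df (X q')).
  move/rowP/(_ i); rewrite [LHS]mxE => ->; rewrite mxE; apply: eq_bigr => j _.
  by rewrite [_^T j i]mxE jacobian_grad.
suff : 'D_(delta_mx 0 i) (f \o X) q' @[q' --> q] -->
  \sum_j grad f (X q) 0 j * grad (fun q => X q 0 j) q 0 i by rewrite -E1.
apply: (@cvg_trans _ ((fun q' => \sum_j grad f (X q') 0 j *
    grad (fun q => X q 0 j) q' 0 i) @ q)).
  by apply: (@near_eq_cvg _ _ (nbhs q)); near=> q'; apply/esym/E1; near: q'; exact: dX.
apply: (@cvg_sumr R _ (nbhs q)) => j; apply: (@cvgM _ _ (nbhs q)).
  rewrite mxE; under eq_fun do rewrite mxE.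
  exact: (cvg_comp _ _ (differentiable_continuous dXq) ((Cf (X q)).2 j)).
by rewrite mxE; under eq_fun do rewrite mxE; exact: (CX j).2.
Unshelve. all: by end_near. Qed.

(** In dimension two [lift i ord0] is the index other than i. *)
Lemma norm_le_coord_pair (q : P) i : `|q| <= `|q 0 i| + `|q 0 (lift i ord0)|.
Proof.
apply: norm_leP => [|j]; first by rewrite addr_ge0.
by case: (unliftP i j) => [k ->|->]; rewrite ?(ord1 k) ?lerDl ?lerDr.
Qed.

Lemma C1_grad_near n (f : 'rV[R]_n.+1 -> R) p : C1_at f p -> forall e, 0 < e ->
  \forall q \near p, forall i, `|grad f q 0 i - grad f p 0 i| <= e.
Proof.
move=> [_ cf] e e0; apply: (@filter_forall _ _ _ (nbhs p)) => i.
have /cvgrPdist_le/(_ e e0) := cf i; rewrite !near_simpl => h.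
by near=> q; rewrite !mxE distrC; near: q.
Unshelve. all: by end_near. Qed.

Lemma C1_local_lipschitz n (f : 'rV[R]_n.+1 -> R) p : C1_at f p ->
  exists2 L, 0 <= L & exists2 r, 0 < r & forall q q', ball p r q -> ball p r q' ->
    `|f q - f q'| <= L * `|q - q'|.
Proof.
move=> Cf; pose K i := `|grad f p 0 i| + 1.
exists (\sum_i K i); first by rewrite sumr_ge0// => i _; rewrite addr_ge0.
have /nbhs_ballP[r /= r0 hr] : nbhs p [set q | differentiable f q /\
    forall i, `|grad f q 0 i - grad f p 0 i| <= 1].
  by apply: filterI; [exact: Cf.1|exact: C1_grad_near Cf _ ltr01].
 exists r => // q q' pq pq'.
have dfr c : ball p r c -> differentiable f c by move=> /hr[].
have [c pc ->] := mean_value_ball dfr pq pq'.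
rewrite mulr_suml (le_trans (ler_norm_sum _ _ _))//; apply: ler_sum => i _.
rewrite normrM ler_pM//; last first.
  by have := coord_le_norm (q - q') i; rewrite !mxE.
have [_ /(_ i) h] := hr _ pc.
by rewrite -(subrK (grad f p 0 i) (grad f c 0 i)) addrC (le_trans (ler_normD _ _))// lerD2l.
Qed.

Lemma chart_lipschitz Gamma X Y x : chart_at Gamma X Y x ->
  exists2 L, 0 <= L & exists2 r, 0 < r & forall q q',
    ball (Y x) r q -> ball (Y x) r q' -> enorm (X q - X q') <= L * `|q - q'|.
Proof.
move=> [_ _ _ [_ CX] _].
have /choice[Lr hLr] : forall j, exists Lr : R * R, [/\ 0 <= Lr.1, 0 < Lr.2 &
    forall q q', ball (Y x) Lr.2 q -> ball (Y x) Lr.2 q' ->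
    `|X q 0 j - X q' 0 j| <= Lr.1 * `|q - q'|].
  by move=> j; have [L L0 [r r0 h]] := C1_local_lipschitz (CX j); exists (L, r).
have /nbhs_ballP[r /= r0 hr] :
    nbhs (Y x) [set q | forall j, ball (Y x) (Lr j).2 q].
  apply: (@filter_forall _ _ _ (nbhs (Y x))) => j; have [_ r0 _] := hLr j.
  by apply/nbhs_ballP; exists (Lr j).2.
have L0 : 0 <= \sum_j (Lr j).1 by rewrite sumr_ge0// => j _; have [] := hLr j.
exists (2 * \sum_j (Lr j).1); first by rewrite mulr_ge0.
exists r => // q q' pq pq'; rewrite (le_trans (enorm_le_norm _))// -mulrA ler_pM2l//.
apply: norm_leP => [|j]; first by rewrite mulr_ge0.
rewrite !mxE; have [_ _ h] := hLr j.
rewrite (le_trans (h q q' (hr _ pq j) (hr _ pq' j)))// ler_wpM2r//.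
by rewrite (bigD1 j)//= lerDl sumr_ge0// => k _; have [] := hLr k.
Qed.

Lemma chart_local Gamma X Y x r : chart_at Gamma X Y x -> 0 < r ->
  exists2 e : R, 0 < e & forall y, Gamma y -> ball x e y ->
    X (Y y) = y /\ ball (Y x) r (Y y).
Proof.
move=> [_ [_ XYy] cY _ _] r0.
have near_r : \forall y \near within Gamma (nbhs x), ball (Y x) r (Y y).
  exact: cY _ (nbhsx_ballx (Y x) _ r0).
have /nbhs_ballP[e /= e0 h] : nbhs x [set y | Gamma y ->
    X (Y y) = y /\ ball (Y x) r (Y y)] by exact: filterI XYy near_r.
by exists e => // y Gy xy; exact: h.
Qed.

(** The shift by 1/2 moves chart coordinates into [0, 1], the range used by the covering lemmas. *)
Lemma ball_half_coord (p q : P) i : ball p 2^-1 q -> 0 <= q 0 i - p 0 i + 2^-1 <= 1.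
Proof.
rewrite -ball_normE /= => pq; have := coord_le_norm (p - q) i.
move=> /le_lt_trans/(_ pq); rewrite !mxE ltr_norml => /andP[h1 h2].
by apply/andP; split; lra.
Qed.

Lemma subr_translate (a b c d : R) : a - c + d - (b - c + d) = a - b.
Proof. by ring. Qed.

Lemma surface_hausdorff2_lt_pinfty Gamma : closed_smooth_surface Gamma ->
  (hausdorff2 Gamma < +oo)%E.
Proof.
move=> sG; apply: hausdorff2_compact_lt_pinfty; first exact: sG.1.
move=> x Gx; have [X [Y]] := surface_charts sG Gx.
rewrite near_withinE => /nbhs_singleton/(_ Gx) ch.
have [L L0 [r r0 hL]] := chart_lipschitz ch.
(* Radius r keeps X Lipschitz, and 1/2 keeps the coordinates in a unit square. *)
pose r' := Num.min r 2^-1; have r'0 : 0 < r' by rewrite lt_min r0 invr_gt0/=.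
have [e e0 he] := chart_local ch r'0.
exists e => //.
have ball_r y : (Gamma `&` ball x e) y -> ball (Y x) r (Y y).
  by move=> [Gy xy]; have [_] := he y Gy xy; apply: le_ball; rewrite ge_min lexx.
have ball_half y : (Gamma `&` ball x e) y -> ball (Y x) 2^-1 (Y y).
  by move=> [Gy xy]; have [_] := he y Gy xy; apply: le_ball; rewrite ge_min lexx orbT.
pose s i y := Y y 0 i - Y x 0 i + 2^-1.
apply: (@hausdorff2_lipschitz_square _ _ (s ord0) (s (lift ord0 ord0)) L).
- by move=> y /ball_half; exact: ball_half_coord.
- by move=> y /ball_half; exact: ball_half_coord.
move=> y z Zy Zz.
have Xy : X (Y y) = y by apply: (he y _ _).1; apply Zy.
have Xz : X (Y z) = z by apply: (he z _ _).1; apply Zz.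
rewrite -{1}Xy -{1}Xz (le_trans (hL _ _ (ball_r _ Zy) (ball_r _ Zz)))//.
rewrite ler_wpM2l// (le_trans (norm_le_coord_pair _ ord0))// !mxE /s.
by rewrite !subr_translate.
Qed.

(* In a chart, f \o X has a partial derivative bounded away from 0 in some
   direction i, so on its zero set the coordinate i is a Lipschitz function of
   the other one. *)
Lemma surface_gradient_zero_set Gamma (f : E -> R) : closed_smooth_surface Gamma ->
  (forall x, C1_at f x) ->
  hausdorff2 [set x | [/\ Gamma x, f x = 0 & surface_gradient Gamma f x != 0]] = 0%E.
Proof.
move=> sG Cf; apply: hausdorff2_null_local => x [Gx fx gx].
have [X [Y]] := surface_charts sG Gx.
rewrite near_withinE => /nbhs_singleton/(_ Gx) ch.
have [XY _ _ [dX CX] _] := ch.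
have Cphi := C1_comp dX CX Cf.
pose phi := f \o X; pose p := Y x.
have gphi : grad phi p = grad f x *m (jacobian X p)^T.
  have := grad_comp (nbhs_singleton dX) (C1_at_differentiable (Cf (X (Y x)))).
  by rewrite XY.
(* If all partial derivatives of [phi] vanished at p, the projection of [grad f x] would be 0,
   against [gx]. *)
have [i gi] : exists i, grad phi p 0 i != 0.
  apply/existsP; apply: contraNT gx; rewrite negb_exists => /forallP g0.
  rewrite (surface_gradient_proj ch (C1_at_differentiable (Cf x))).
  apply/eqP/tangent_proj_eq0; rewrite -gphi.
  by apply/rowP => i; rewrite [RHS]mxE; have := g0 i; rewrite negbK => /eqP.
(* Near p the derivative in direction i stays at least m in absolute value, and the one in the other
   direction k at most K. *)
pose m := `|grad phi p 0 i| / 2; have m0 : 0 < m by rewrite divr_gt0 ?normr_gt0.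
pose k := lift i ord0; pose K := `|grad phi p 0 k| + m.
have K0 : 0 <= K by rewrite addr_ge0// ltW.
have /nbhs_ballP[r1 /= r10 hr1] : nbhs p [set q | differentiable phi q /\
    forall i, `|grad phi q 0 i - grad phi p 0 i| <= m].
  by apply: filterI; [exact: Cphi.1|exact: C1_grad_near Cphi _ m0].
have zero_lip q q' : ball p r1 q -> ball p r1 q' -> phi q = 0 -> phi q' = 0 ->
    `|q - q'| <= (1 + K / m) * `|q 0 k - q' 0 k|.
  move=> pq pq' q0 q'0.
  have dr c : ball p r1 c -> differentiable phi c by move=> /hr1[].
  (* Between two zeros of [phi] the two terms of the mean value formula cancel, so the increment in
     direction i is controlled by that in direction k. *)
  have [c pc] := mean_value_ball dr pq pq'; rewrite q0 q'0 subrr.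
  rewrite (bigD1_ord i)//= big_ord1 -/k.
  have [_ hc] := hr1 _ pc; have hi := hc i; have hk := hc k.
  have gi_ge : m <= `|grad phi c 0 i|.
    have := lerB_dist (grad phi p 0 i) (grad phi p 0 i - grad phi c 0 i).
    by rewrite subKr distrC; move: hi; rewrite /m; lra.
  have gk_le : `|grad phi c 0 k| <= K.
    rewrite -(subrK (grad phi p 0 k) (grad phi c 0 k)) addrC.
    by rewrite (le_trans (ler_normD _ _))// lerD2l.
  move=> /esym/eqP; rewrite addr_eq0 => /eqP/(congr1 Num.norm).
  rewrite normrN !normrM => eqik.
  have di : `|q 0 i - q' 0 i| <= K / m * `|q 0 k - q' 0 k|.
    rewrite mulrAC ler_pdivlMr// mulrC.
    rewrite (le_trans (ler_wpM2r (normr_ge0 _) gi_ge))// eqik.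
    by rewrite ler_wpM2r.
  rewrite (le_trans (norm_le_coord_pair _ i))// !mxE -/k mulrDl mul1r.
  by rewrite [leLHS]addrC lerD2l.
have [L L0 [r2 r20 hL]] := chart_lipschitz ch.
pose r' := Num.min (Num.min r1 r2) 2^-1.
have r'0 : 0 < r' by rewrite !lt_min r10 r20 invr_gt0/=.
have [e e0 he] := chart_local ch r'0; exists e => //.
set Z := _ `&` _.
have ball_r r y : Z y -> r' <= r -> ball (Y x) r (Y y).
  by move=> [[Gy _ _] xy] r'r; have [_] := he y Gy xy; exact: le_ball.
have r'1 : r' <= r1 by rewrite !ge_min lexx.
have r'2 : r' <= r2 by rewrite !ge_min lexx orbT.
have r'3 : r' <= 2^-1 by rewrite !ge_min lexx orbT.
apply: (@hausdorff2_lipschitz_curve _ _ (fun y => Y y 0 k - p 0 k + 2^-1)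
  (L * (1 + K / m))) => [y /ball_r/(_ r'3)|y z Zy Zz].
  exact: ball_half_coord.
have Xy : X (Y y) = y by apply: (he y _ _).1; case: Zy => -[].
have Xz : X (Y z) = z by apply: (he z _ _).1; case: Zz => -[].
have phiy : phi (Y y) = 0 by rewrite /phi/= Xy; case: Zy => -[].
have phiz : phi (Y z) = 0 by rewrite /phi/= Xz; case: Zz => -[].
rewrite -{1}Xy -{1}Xz.
rewrite (le_trans (hL _ _ (ball_r _ _ Zy r'2) (ball_r _ _ Zz r'2)))//.
rewrite -mulrA ler_wpM2l//.
rewrite (le_trans (zero_lip _ _ (ball_r _ _ Zy r'1) (ball_r _ _ Zz r'1) phiy phiz))//.
by rewrite !subr_translate.
Qed.

End Surface.

(** * Integration of piecewise continuous functions on a surface *)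

Section SurfaceIntegral.
Variable R : realType.
Local Notation E := 'rV[R]_3.
Local Notation S := (caratheodory_type (@hausdorff2_outer R)).
Local Notation mu := (@surface_measure R).
Implicit Types (Gamma N : set S).

Lemma closed_cara_measurable (F : set E) : closed F -> measurable (F : set S).
Proof. exact: caratheodory_closed. Qed.

Lemma null_cara_measurable N : hausdorff2 N = 0%E -> measurable N.
Proof.
move=> N0; apply: le_caratheodory_measurable => X.
rewrite [X in (X + _)%E](hausdorff2_null_subset _ N0) ?add0e; last by move=> ? [].
exact: hausdorff2_subset.
Qed.

Lemma within_continuous_preimage Gamma (h : S -> R) : closed (Gamma : set E) ->
  {within (Gamma : set E), continuous (h : E -> R)} ->
  measurable_fun Gamma h.
Proof.
move=> cG ch.
apply: (measurability _ (RGenOInfty.measurableE R)) => _ [_ [r ->] <-].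
have oU : open (h @^-1` `]r, +oo[ : set (subspace (Gamma : set E))).
  by move/continuousP : ch; apply; exact: interval_open.
have [V oV VG] := (open_subspaceP _ _).1 oU.
rewrite setIC -VG; apply: measurableI; last exact: closed_cara_measurable.
by rewrite -[V]setCK; apply: measurableC; apply: closed_cara_measurable; exact: open_closedC.
Qed.

Section Piecewise.
Variables (Gamma N : set S) (I : finType) (D : {set I}) (F : I -> set E).
Hypothesis cptG : compact (Gamma : set E).
Hypothesis finG : (hausdorff2 Gamma < +oo)%E.
Hypothesis N0 : hausdorff2 N = 0%E.
Hypothesis closedF : forall i, closed (F i).
Hypothesis coverF : forall x, Gamma x -> ~ N x -> exists2 i, i \in D & F i x.

(** Each h i is continuous on all of [Gamma], hence bounded and measurable there; only its agreement
    with f is confined to F i minus N. On N the function f is unconstrained. *)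
Definition piecewise_continuous (f : S -> R) := exists h : I -> E -> R,
  (forall i, i \in D -> {within (Gamma : set E), continuous (h i)}) /\
  forall i x, i \in D -> Gamma x -> ~ N x -> F i x -> f x = h i x.

Let closedG : closed (Gamma : set E).
Proof. by apply: compact_closed => //; exact: norm_hausdorff. Qed.

Let mG : measurable Gamma. Proof. exact: closed_cara_measurable. Qed.
Let mN : measurable N. Proof. exact: null_cara_measurable. Qed.

(** Every subset of a null set is Caratheodory measurable, so the values of f on N do no harm. *)
Lemma piecewise_continuous_measurable f : piecewise_continuous f ->
  measurable_fun Gamma f.
Proof.
move=> [h [ch fh]] _ B mB.
rewrite (_ : Gamma `&` _ = (Gamma `&` N `&` f @^-1` B) `|`
  \bigcup_(i in [set i | i \in D]) ((Gamma `&` h i @^-1` B) `&` (F i `\` N))).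
  apply: measurableU.
    apply: null_cara_measurable; apply: hausdorff2_null_subset N0.
    by move=> x [[]].
  apply: fin_bigcup_measurable => // i iD; apply: measurableI.
    by apply: within_continuous_preimage => //; exact: ch.
  by apply: measurableD => //; exact: closed_cara_measurable.
apply/seteqP; split => [x [Gx Bx]|x [[[Gx _] Bx]//|[i iD [[Gx Bx] [Fx Nx]]]]].
  have [Nx|Nx] := pselect (N x); first by left.
  have [i iD Fx] := coverF Gx Nx; right; exists i => //; split; split => //=.
  by rewrite -(fh i x).
by split => //=; rewrite (fh i x).
Qed.

(** N is removed because f may be unbounded on it. *)
Lemma piecewise_continuous_integrable f : piecewise_continuous f ->
  mu.-integrable (Gamma `\` N) (EFin \o f).
Proof.
move=> pf; apply: measurable_bounded_integrable.
- exact: measurableD.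
- by apply: le_lt_trans finG; apply: hausdorff2_subset => x [].
- by apply: measurable_funS (piecewise_continuous_measurable pf) => // x [].
have [h [ch fh]] := pf.
have /choice[M hM] : forall i, exists M : R, i \in D -> forall x, Gamma x -> `|h i x| <= M.
  move=> i; have [iD|_] := boolP (i \in D); last by exists 0.
  have /compact_bounded[M [_ hM]] := continuous_compact (ch i iD) cptG.
  exists (M + 1) => _ x Gx; apply: hM; first by rewrite ltrDl.
  by exists x.
exists (\sum_i `|M i|); split; first exact: num_real.
move=> K hK x [Gx Nx]; have [i iD Fx] := coverF Gx Nx.
rewrite /= (fh i x)// (le_trans (hM i iD x Gx))// (le_trans (ler_norm _))//.
by rewrite (le_trans _ (ltW hK))// (bigD1 i)//= lerDl sumr_ge0.
Qed.

Lemma surface_integral_piecewise f : piecewise_continuous f ->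
  surface_integral Gamma f = \int[mu]_(x in Gamma `\` N) f x.
Proof.
move=> pf; rewrite /surface_integral /Rintegral; congr fine.
have mf := (measurable_EFinP _ _).2 (piecewise_continuous_measurable pf).
apply: negligible_integral => //.
apply: (@negligible_integrable _ _ _ mu Gamma N _ mN mG mf N0).2.
exact: piecewise_continuous_integrable.
Qed.

Lemma Rintegral_sum (A : set S) (J : finType) (c : J -> R) (f : J -> S -> R) :
  measurable A -> (forall j, mu.-integrable A (EFin \o f j)) ->
  \int[mu]_(x in A) (\sum_j c j * f j x) = \sum_j c j * \int[mu]_(x in A) f j x.
Proof.
move=> mA intf.
have intcf j : mu.-integrable A (EFin \o (fun x => c j * f j x)).
  rewrite (_ : _ \o _ = fun x => ((c j)%:E * (EFin \o f j) x)%E); last first.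
    by apply/funext => x /=; rewrite EFinM.
  exact: integrableZl.
elim: (index_enum J) => [|j s IHs].
  rewrite big_nil; under eq_Rintegral do rewrite big_nil.
  by rewrite Rintegral_cst// mul0r.
rewrite big_cons; under eq_Rintegral do rewrite big_cons.
rewrite RintegralD//; first by rewrite RintegralZl// IHs.
rewrite (_ : _ \o _ = fun x => (\sum_(i <- s) (c i * f i x)%:E)%E); last first.
  by apply/funext => x /=; rewrite sumEFin.
by apply: integrable_sum => // i _; exact: intcf.
Qed.

Lemma surface_integral_sum (J : finType) (c : J -> R) (f : J -> S -> R) (g : S -> R) :
  piecewise_continuous g -> (forall j, piecewise_continuous (f j)) ->
  (forall x, Gamma x -> ~ N x -> g x = \sum_j c j * f j x) ->
  surface_integral Gamma g = \sum_j c j * surface_integral Gamma (f j).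
Proof.
move=> pg pf gf; rewrite surface_integral_piecewise//.
under eq_bigr do rewrite surface_integral_piecewise//.
rewrite -Rintegral_sum; last 2 first.
- exact: measurableD.
- by move=> j; exact: piecewise_continuous_integrable.
by apply: eq_Rintegral => x /set_mem[Gx Nx]; exact: gf.
Qed.

End Piecewise.
End SurfaceIntegral.

(** * Tetrahedra and the cut mesh *)

Lemma cvg_sumv (R : realType) (T : Type) (F : set_system T) {FF : Filter F}
    (V : normedModType R) (I : Type) (r : seq I) (f : I -> T -> V) (l : I -> V) :
  (forall i, f i y @[y --> F] --> l i) ->
  \sum_(i <- r) f i y @[y --> F] --> \sum_(i <- r) l i.
Proof. by move=> fl; apply: cvg_big => //; exact: add_continuous. Qed.

(** The hull is a continuous image of the standard simplex, a closed part of the compact unit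
    cube. *)
Lemma convex_hull_closed (R : realType) n (v : 'I_n.+1 -> 'rV[R]_3) :
  closed (convex_hull v).
Proof.
pose comb (l : 'rV[R]_n.+1) : 'rV[R]_3 := \sum_i l 0 i *: v i.
pose box := [set l : 'rV[R]_n.+1 | forall i, `[0, 1]%classic (l ord0 i)].
pose plane := [set l : 'rV[R]_n.+1 | \sum_i l 0 i = 1].
have ccomb : continuous comb.
  move=> l; suff : \sum_i (m : 'rV[R]_n.+1) 0 i *: v i @[m --> l] -->
      \sum_i l 0 i *: v i by [].
  apply: (@cvg_sumv R _ (nbhs l)) => i.
  exact: (cvgZr_tmp (@coord_continuous R _ _ ord0 i l)).
have cbox : compact box.
  apply: (@rV_compact R _ (fun=> `[0 : R, 1]%classic)) => i.
  exact: segment_compact.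
have cplane : closed plane.
  apply: (@closed_comp _ _ (fun l : 'rV[R]_n.+1 => \sum_i l 0 i) [set 1]).
    move=> l _; suff : \sum_i (m : 'rV[R]_n.+1) 0 i @[m --> l] -->
        \sum_i l 0 i by [].
    apply: (@cvg_sumv R _ (nbhs l)) => i.
    exact: (@coord_continuous R _ _ ord0 i l).
  exact: closed_eq.
have -> : convex_hull v = comb @` (box `&` plane).
  apply/seteqP; split => [x [l [l0 l1 ->]]|_ [l [lb l1] <-]].
    exists (\row_i l i); last by apply: eq_bigr => i _; rewrite mxE.
    split; last by rewrite /plane/= -l1; apply: eq_bigr => i _; rewrite mxE.
    move=> i; rewrite mxE /= in_itv/= l0 -l1 (bigD1 i)//= lerDl.
    by rewrite sumr_ge0.
  exists (fun i => l 0 i); split => // i.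
  by have := lb i; rewrite /= in_itv/= => /andP[].
apply: compact_closed; first exact: norm_hausdorff.
apply: continuous_compact; last exact: compact_closedI.
exact: continuous_subspaceT.
Qed.

Lemma face_sub_tet (R : realType) (I : finType) (Th : I -> 'I_4 -> 'rV[R]_3) T j :
  face Th T j `<=` tet Th T.
Proof.
move=> x [l [l0 l1 ->]]; pose l' i := if unlift j i is Some k then l k else 0.
exists l'; split.
- by move=> i; rewrite /l'; case: unliftP.
- rewrite (bigD1_ord j)//= {1}/l' unlift_none add0r -l1.
  by apply: eq_bigr => i _; rewrite /l' liftK.
- rewrite [RHS](bigD1_ord j)//= {1}/l' unlift_none scale0r add0r.
  by apply: eq_bigr => i _; rewrite /l' liftK.
Qed.

Section TraceGradient.
Variable R : realType.
Local Notation E := 'rV[R]_3.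
Variables (Gamma : set E) (I : finType) (Th : I -> 'I_4 -> E) (ThG : {set I}).

Definition cut_null : set E :=
  \bigcup_(T in [set T | hausdorff2 (cut_part Gamma Th T) = 0%E]) cut_part Gamma Th T.

Lemma hausdorff2_cut_null : hausdorff2 cut_null = 0%E.
Proof. by apply: hausdorff2_null_bigcup_countable => //; exact: countableP. Qed.

(* A tetrahedron through y not in ThG is either in the null part or shares a face
   carrying its whole cut with a kept neighbour. *)
Lemma cut_mesh_cover : Gamma `<=` \bigcup_T tet Th T -> cut_mesh Gamma Th ThG ->
  forall x, Gamma x -> ~ cut_null x -> \forall y \near within Gamma (nbhs x),
  exists T, [/\ T \in ThG, tet Th T x & tet Th T y].
Proof.
move=> GTh [_ dropped _] x Gx Nx.
(* The tetrahedra are finitely many and closed, so those that avoid x avoid a neighbourhood of x;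
   hence a tetrahedron found for y also contains x. *)
have near_tets : \forall y \near within Gamma (nbhs x), forall T,
    tet Th T y -> tet Th T x.
  apply: filter_forall => T; have [Tx|Tx] := pselect (tet Th T x).
    by near=> y.
  have nT : \forall y \near x, ~ tet Th T y.
    apply: open_nbhs_nbhs; split=> //; apply: closed_openC; exact: convex_hull_closed.
  have {}nT : \forall y \near within Gamma (nbhs x), ~ tet Th T y.
    by apply: cvg_within; exact: nT.
  by near=> y => Ty; exfalso; move: Ty; near: y.
near=> y; have Gy : Gamma y by near: y; exact: withinT.
have [T _ Ty] := GTh _ Gy.
have Tx : tet Th T x by move: Ty; apply: (near near_tets y).
have [TG|TG] := boolP (T \in ThG); first by exists T.
have [T0|Tn0] := pselect (hausdorff2 (cut_part Gamma Th T) = 0%E).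
  by exfalso; apply: Nx; exists T.
have [T' [T'G _ [j [j' [ff' cut_f]]]]] := dropped T Tn0 TG.
exists T'; split => //; apply: (@face_sub_tet _ _ _ _ j'); rewrite -ff'.
  by apply: cut_f.
by apply: cut_f.
Unshelve. all: by end_near. Qed.

End TraceGradient.

(** * Linearity of surface gradients of differentiable functions *)

Lemma gradB (R : realType) n (f g : 'rV[R]_n.+1 -> R) x :
  differentiable f x -> differentiable g x ->
  grad (fun y => f y - g y) x = grad f x - grad g x.
Proof.
move=> df dg; apply/rowP => i; rewrite !mxE.
by apply: deriveB; exact: diff_derivable.
Qed.

Lemma C1B (R : realType) n (f g : 'rV[R]_n.+1 -> R) x : C1_at f x -> C1_at g x ->
  C1_at (fun y => f y - g y) x.
Proof.
move=> Cf Cg; have -> : (fun y => f y - g y) = fun y => f y + (-1) * g y.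
  by apply/funext => y; rewrite mulN1r.
by apply: C1D => //; apply: C1M => //; exact: C1_cst.
Qed.

Lemma C1_continuous (R : realType) (f : 'rV[R]_3 -> R) A : (forall x, C1_at f x) ->
  {within A, continuous f}.
Proof.
move=> Cf; apply: continuous_subspaceT => x.
by apply: differentiable_continuous; exact: C1_at_differentiable.
Qed.

Section SurfaceGradient.
Variable R : realType.
Local Notation E := 'rV[R]_3.
Variable Gamma : set E.
Hypothesis sG : closed_smooth_surface Gamma.

Lemma surface_chart x : Gamma x -> exists X Y, chart_at Gamma X Y x.
Proof.
move=> Gx; have [X [Y]] := surface_charts sG Gx.
by rewrite near_withinE => /nbhs_singleton/(_ Gx) ch; exists X, Y.
Qed.

Lemma surface_gradientP (f : E -> R) x : Gamma x -> differentiable f x ->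
  is_surface_gradient Gamma f x (surface_gradient Gamma f x).
Proof.
move=> Gx df; have [X [Y ch]] := surface_chart Gx.
by rewrite (surface_gradient_proj ch df); exact: chart_gradient.
Qed.

Lemma surface_gradientB (f g : E -> R) x : Gamma x ->
  differentiable f x -> differentiable g x ->
  surface_gradient Gamma (fun y => f y - g y) x =
  surface_gradient Gamma f x - surface_gradient Gamma g x.
Proof.
move=> Gx df dg; have [X [Y ch]] := surface_chart Gx.
rewrite !(surface_gradient_proj ch)//; last exact: differentiableB.
by rewrite gradB// /tangent_proj !mulmxBl.
Qed.

(** In one chart all these gradients have the form v J, and so does their combination. *)
Lemma tangent_sum (J : finType) (c : J -> R) (f : J -> E -> R) x : Gamma x ->
  (forall j, differentiable (f j) x) ->
  tangent Gamma x (\sum_j c j *: surface_gradient Gamma (f j) x).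
Proof.
move=> Gx df; have [X [Y ch]] := surface_chart Gx.
under eq_bigr do rewrite (surface_gradient_proj ch)// /tangent_proj scalemxAl.
by rewrite -mulmx_suml; exact: chart_tangent ch.
Qed.

End SurfaceGradient.

(** * Traces of piecewise polynomials *)

Section PiecewisePolynomial.
Variable R : realType.
Local Notation E := 'rV[R]_3.
Variables (Gamma : set E) (I : finType) (Th : I -> 'I_4 -> E) (ThG : {set I}).
Variables (M : nat) (phi : 'I_M -> E -> R) (p : 'I_M -> I -> E -> R).
Hypothesis sG : closed_smooth_surface Gamma.
Hypothesis Gamma_sub : Gamma `<=` \bigcup_T tet Th T.
Hypothesis meshG : cut_mesh Gamma Th ThG.
Hypothesis p_C1 : forall l T x, C1_at (p l T) x.
Hypothesis phi_p : forall l T x, T \in ThG -> tet Th T x -> phi l x = p l T x.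

Let dp l T x : differentiable (p l T) x := C1_at_differentiable (p_C1 l T x).

(* Off this set the pieces through a point share their surface gradient, whatever
   the position of Gamma relative to the faces. *)
Definition kink : set E := \bigcup_(i : 'I_M * I * I)
  [set x | [/\ Gamma x, p i.1.1 i.1.2 x - p i.1.1 i.2 x = 0 &
     surface_gradient Gamma (fun y => p i.1.1 i.1.2 y - p i.1.1 i.2 y) x != 0]].

Definition exceptional : set E := cut_null Gamma Th `|` kink.

Lemma hausdorff2_exceptional : hausdorff2 exceptional = 0%E.
Proof.
apply: hausdorff2_le0.
apply: le_trans (outer_measureU2 (@hausdorff2_outer R) _ _) _.
rewrite [X in (X + _)%E](hausdorff2_cut_null Gamma Th) add0e.
rewrite [leLHS](_ : _ = 0%E)//; apply: hausdorff2_null_bigcup_countable.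
  exact: countableP.
by move=> i _; apply: surface_gradient_zero_set => // x; exact: C1B.
Qed.

Lemma exceptional_cover x : Gamma x -> ~ exceptional x ->
  exists2 T, T \in ThG & tet Th T x.
Proof.
move=> Gx Nx; have Nx' : ~ cut_null Gamma Th x by move=> ?; apply: Nx; left.
have := cut_mesh_cover Gamma_sub meshG Gx Nx'.
by rewrite near_withinE => /nbhs_singleton/(_ Gx)[T [TG Tx _]]; exists T.
Qed.

(** The tetrahedron containing y varies with y, so the first-order estimate is taken for all the
    finitely many pieces at once; off [kink] the pieces through x have one common gradient. *)
Lemma trace_gradientP l T x : Gamma x -> ~ exceptional x -> T \in ThG ->
  tet Th T x ->
  is_surface_gradient Gamma (phi l) x (surface_gradient Gamma (p l T) x).
Proof.
move=> Gx Nx TG Tx; split.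
  by have [] := surface_gradientP sG Gx (dp l T x).
move=> e e0; have Nx' : ~ cut_null Gamma Th x by move=> ?; apply: Nx; left.
have near_T := cut_mesh_cover Gamma_sub meshG Gx Nx'.
have near_p : \forall y \near within Gamma (nbhs x), forall T',
    `|p l T' y - p l T' x - dot (surface_gradient Gamma (p l T') x) (y - x)|
    <= e * enorm (y - x).
  by apply: filter_forall => T'; apply: (surface_gradientP sG Gx (dp l T' x)).2.
near=> y.
have [T' [T'G T'x T'y]] : exists T, [/\ T \in ThG, tet Th T x & tet Th T y].
  by near: y.
rewrite (phi_p _ T'G T'y) (phi_p _ T'G T'x).
suff -> : surface_gradient Gamma (p l T) x = surface_gradient Gamma (p l T') x.
  by move: (T'); near: y.
(* Both pieces take the value of [phi l] at x, so different gradients would put x in [kink]. *)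
apply/eqP; rewrite -subr_eq0 -surface_gradientB//; apply: contrapT => /negP gne.
apply: Nx; right; exists (l, T, T') => //; split => //=.
by rewrite -!phi_p// subrr.
Unshelve. all: by end_near. Qed.

Lemma surface_gradient_trace l T x : Gamma x -> ~ exceptional x -> T \in ThG ->
  tet Th T x ->
  surface_gradient Gamma (trace Gamma (phi l)) x = surface_gradient Gamma (p l T) x.
Proof.
move=> Gx Nx TG Tx; apply: surface_gradientE.
apply: near_is_surface_gradient (trace_gradientP l Gx Nx TG Tx).
  by rewrite /trace patchE mem_set.
by near=> y; rewrite /trace patchE mem_set//; near: y; exact: withinT.
Unshelve. all: by end_near. Qed.

(** The gradient of the combination is built from the pieces of a tetrahedron through x, then
    carried over to the trace of [phi l] by equality on [Gamma], where [phi_c] applies. *)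
Lemma surface_gradient_trace_sum n (c : 'I_M -> 'I_n -> R) (w : 'I_n -> 'I_M) l x :
  (forall l x, Gamma x -> phi l x = \sum_i c l i * phi (w i) x) ->
  Gamma x -> ~ exceptional x ->
  surface_gradient Gamma (trace Gamma (phi l)) x =
  \sum_i c l i *: surface_gradient Gamma (trace Gamma (phi (w i))) x.
Proof.
move=> phi_c Gx Nx; have [T TG Tx] := exceptional_cover Gx Nx.
under eq_bigr do rewrite (surface_gradient_trace _ Gx Nx TG Tx).
apply: surface_gradientE.
apply: (@near_is_surface_gradient _ _ (fun y => \sum_i c l i * phi (w i) y)).
- by rewrite /trace patchE mem_set// phi_c.
- by near=> y; rewrite /trace patchE mem_set ?phi_c//; near: y; exact: withinT.
- apply: is_surface_gradient_sum => [i|]; first exact: trace_gradientP.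
  by apply: tangent_sum => // i; exact: dp.
Unshelve. all: by end_near. Qed.

Lemma piecewise_form_a l m :
  piecewise_continuous Gamma exceptional ThG (tet Th)
    (fun x => dot (surface_gradient Gamma (trace Gamma (phi l)) x)
                  (surface_gradient Gamma (trace Gamma (phi m)) x)).
Proof.
exists (fun T x => dot (surface_gradient Gamma (p l T) x)
                       (surface_gradient Gamma (p m T) x)); split.
  by move=> T _; exact: continuous_dot_surface_gradient.
by move=> T x TG Gx Nx Tx; rewrite !(surface_gradient_trace _ Gx Nx TG Tx).
Qed.

Lemma piecewise_form_l2 l m :
  piecewise_continuous Gamma exceptional ThG (tet Th)
    (fun x => trace Gamma (phi l) x * trace Gamma (phi m) x).
Proof.
exists (fun T x => p l T x * p m T x); split.
  by move=> T _; apply: C1_continuous => x; exact: C1M.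
move=> T x TG Gx Nx Tx; rewrite /trace !patchE mem_set//.
by rewrite (phi_p l TG Tx) (phi_p m TG Tx).
Qed.

Let closed_tet T : closed (tet Th T). Proof. exact: convex_hull_closed. Qed.

(** Here f stands for the integrand of either form; summing over pairs of indices reduces
    bilinearity to linearity of one integral. *)
Lemma surface_integral_bilinear n (c : 'I_M -> 'I_n -> R) (w : 'I_n -> 'I_M)
    (f : 'I_M -> 'I_M -> E -> R) l m :
  (forall l m, piecewise_continuous Gamma exceptional ThG (tet Th) (f l m)) ->
  (forall x, Gamma x -> ~ exceptional x ->
    f l m x = \sum_i \sum_j c l i * c m j * f (w i) (w j) x) ->
  surface_integral Gamma (f l m) =
  \sum_i \sum_j c l i * c m j * surface_integral Gamma (f (w i) (w j)).
Proof.
move=> pf f_c; rewrite pair_big/=.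
apply: (surface_integral_sum sG.1 (surface_hausdorff2_lt_pinfty sG)
  hausdorff2_exceptional closed_tet exceptional_cover (pf l m)
  (fun ij : 'I_n * 'I_n => pf (w ij.1) (w ij.2))) => x Gx Nx.
by rewrite f_c// pair_big.
Qed.

Lemma form_a_bilinear n (c : 'I_M -> 'I_n -> R) (w : 'I_n -> 'I_M) l m :
  (forall l x, Gamma x -> phi l x = \sum_i c l i * phi (w i) x) ->
  form_a Gamma (trace Gamma (phi l)) (trace Gamma (phi m)) =
  \sum_i \sum_j c l i * c m j *
    form_a Gamma (trace Gamma (phi (w i))) (trace Gamma (phi (w j))).
Proof.
move=> phi_c; apply: (@surface_integral_bilinear _ c w
  (fun l m x => dot (surface_gradient Gamma (trace Gamma (phi l)) x)
                    (surface_gradient Gamma (trace Gamma (phi m)) x)) l m).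
  exact: piecewise_form_a.
move=> x Gx Nx; rewrite !(surface_gradient_trace_sum _ phi_c Gx Nx).
rewrite dot_suml; apply: eq_bigr => i _; rewrite dot_sumr; apply: eq_bigr => j _.
by rewrite dotZl dotC dotZl dotC mulrA.
Qed.

Lemma form_l2_bilinear n (c : 'I_M -> 'I_n -> R) (w : 'I_n -> 'I_M) l m :
  (forall l x, Gamma x -> phi l x = \sum_i c l i * phi (w i) x) ->
  form_l2 Gamma (trace Gamma (phi l)) (trace Gamma (phi m)) =
  \sum_i \sum_j c l i * c m j *
    form_l2 Gamma (trace Gamma (phi (w i))) (trace Gamma (phi (w j))).
Proof.
move=> phi_c; apply: (@surface_integral_bilinear _ c w
  (fun l m x => trace Gamma (phi l) x * trace Gamma (phi m) x) l m).
  exact: piecewise_form_l2.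
move=> x Gx Nx; rewrite /trace !patchE mem_set// !phi_c// mulr_suml.
apply: eq_bigr => i _; rewrite mulr_sumr; apply: eq_bigr => j _.
by rewrite !patchE mem_set// mulrACA.
Qed.

End PiecewisePolynomial.

(** * From the finite element bases to the matrices *)

Lemma Wh_polynomial_pieces (R : realType) k (I : finType)
    (Th : I -> 'I_4 -> 'rV[R]_3) (ThG : {set I}) n (phi : 'I_n -> 'rV[R]_3 -> R^o) :
  (forall l, Wh k Th ThG (phi l)) ->
  exists p : 'I_n -> I -> 'rV[R]_3 -> R,
    (forall l T x, C1_at (p l T) x) /\
    forall l T x, T \in ThG -> tet Th T x -> phi l x = p l T x.
Proof.
move=> Wphi.
have /choice[q hq] : forall lT : 'I_n * I, exists q : 'rV[R]_3 -> R,
    (forall x, C1_at q x) /\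
    (lT.2 \in ThG -> forall x, tet Th lT.2 x -> phi lT.1 x = q x).
  move=> [l T] /=; have [TG|_] := boolP (T \in ThG); last first.
    (* A tetrahedron outside [ThG] carries no piece; 0 is a filler. *)
    by exists (fun=> 0); split => // x; exact: C1_cst.
  have [_ _ /(_ T TG)[g [pg fg]]] := Wphi l.
  by exists g; split => // x; exact: C1_poly pg.
exists (fun l T => q (l, T)); split => [l T|l T x TG].
  exact: (hq (l, T)).1.
exact: (hq (l, T)).2.
Qed.

Lemma sub_partition_cover (R : realType) (Omega Gamma : set 'rV[R]_3)
    (I : finType) (Th : I -> 'I_4 -> 'rV[R]_3) :
  Gamma `<=` Omega -> tetrahedral_partition Omega Th ->
  Gamma `<=` \bigcup_T tet Th T.
Proof.
by move=> GO [_ -> _] x /GO; exact: subset_closure.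
Qed.

Lemma bilinear_mulmx (R : realType) m n (P : 'M[R]_(m, n)) (S : 'M[R]_n) i j :
  (P *m S *m P^T) i j = \sum_k \sum_l P i k * P j l * S k l.
Proof.
rewrite mxE exchange_big/=; apply: eq_bigr => l _.
rewrite !mxE mulr_suml; apply: eq_bigr => k _.
by rewrite mulrAC.
Qed.

Lemma basis_coordinates_unique (F : fieldType) (V : lmodType F) (S : set V) n
    (b : 'I_n -> V) (c : 'I_n -> F) i :
  is_basis S b -> b i = \sum_j c j *: b j -> forall j, c j = (i == j)%:R.
Proof.
move=> [_ free _] bi j; apply/eqP; rewrite -subr_eq0; apply/eqP.
apply: (free (fun j => c j - (i == j)%:R)).
under eq_bigr do rewrite scalerBl; rewrite sumrB -bi.
rewrite (bigD1 i)//= eqxx scale1r big1 ?addr0 ?subrr// => k ki.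
by rewrite eq_sym (negbTE ki) scale0r.
Qed.

Unset Implicit Arguments.
Theorem theorem4p1 (R : realType) (Omega Gamma : set 'rV[R]_3)
    (I : finType) (Th : I -> 'I_4 -> 'rV[R]_3) (kappa : R) (ThG : {set I})
    (k M K : nat) (phi : 'I_M -> ('rV[R]_3 -> R^o))
    (A B : 'M[R]_M) (At Bt : 'M[R]_(M - K))
    (hOmega : bounded_domain Omega)
    (hGamma : closed_smooth_surface Gamma)
    (hGammaOmega : Gamma `<=` Omega)
    (hTh : tetrahedral_partition Omega Th)
    (hkappa : shape_regular kappa Th)
    (hThG : cut_mesh Gamma Th ThG)
    (hk : (1 <= k)%N)
    (hM : M = subspace_dim (Wh k Th ThG))
    (hK : K = (subspace_dim (Wh k Th ThG) - subspace_dim (Vh Gamma k Th ThG))%N)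
    (hphi : is_basis (Wh k Th ThG) phi)
    (htrace : is_basis (Vh Gamma k Th ThG)
       (fun i : 'I_(M - K) => trace Gamma (phi (widen_ord (leq_subr K M) i))))
    (hA : forall i j, A i j = form_a Gamma (trace Gamma (phi i)) (trace Gamma (phi j)))
    (hB : forall i j, B i j = form_l2 Gamma (trace Gamma (phi i)) (trace Gamma (phi j)))
    (hAt : forall i j, At i j =
       form_a Gamma (trace Gamma (phi (widen_ord (leq_subr K M) i)))
                    (trace Gamma (phi (widen_ord (leq_subr K M) j))))
    (hBt : forall i j, Bt i j =
       form_l2 Gamma (trace Gamma (phi (widen_ord (leq_subr K M) i)))
                     (trace Gamma (phi (widen_ord (leq_subr K M) j)))) :
  forall lambda : R[i],
    finite_eigenvalue (complexify A) (complexify B) lambda <->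
    finite_eigenvalue (complexify At) (complexify Bt) lambda.
Proof.
have [Wphi _ _] := hphi.
have [p [p_C1 phi_p]] := Wh_polynomial_pieces Wphi.
have Gsub := sub_partition_cover hGammaOmega hTh.
pose w := widen_ord (leq_subr K M).
have [_ _ span] := htrace.
(* [Vh] is the image of [Wh] under [trace], so every trace of a basis function is in the span. *)
have /choice[c trace_c] : forall l, exists c : 'I_(M - K) -> R,
    trace Gamma (phi l) = \sum_i c i *: trace Gamma (phi (w i)).
  by move=> l; apply: span; exists (phi l).
have phi_c l x : Gamma x -> phi l x = \sum_i c l i * phi (w i) x.
  move=> Gx; have := congr1 (fun f => f x) (trace_c l).
  rewrite fct_sumE {1}/trace patchE mem_set// => ->; apply: eq_bigr => i _.
  by rewrite fctE /trace patchE mem_set.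
pose P : 'M[R]_(M, M - K) := \matrix_(l, i) c l i.
have fullP : row_full P.
  (* The left inverse selects the rows [w i], on which P is the identity by freeness of the trace
     basis. *)
  apply/row_fullP; exists (\matrix_(i, l) (w i == l)%:R); apply/matrixP => i j.
  rewrite !mxE (bigD1 (w i))//= big1 ?addr0 => [|l li].
    rewrite !mxE eqxx mul1r; exact: (basis_coordinates_unique htrace (trace_c (w i))).
  by rewrite !mxE eq_sym (negbTE li) mul0r.
have EA : A = P *m At *m P^T.
  apply/matrixP => i j; rewrite hA bilinear_mulmx.
  rewrite (form_a_bilinear hGamma Gsub hThG p_C1 phi_p _ _ phi_c).
  by apply: eq_bigr => k' _; apply: eq_bigr => l _; rewrite !mxE hAt.
have EB : B = P *m Bt *m P^T.
  apply/matrixP => i j; rewrite hB bilinear_mulmx.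
  rewrite (form_l2_bilinear hGamma Gsub hThG p_C1 phi_p _ _ phi_c).
  by apply: eq_bigr => k' _; apply: eq_bigr => l _; rewrite !mxE hBt.
(* Complexification commutes with products and transposition and keeps P of full rank, so the
   congruence serves complex pencils. *)
move=> lambda; rewrite EA EB /complexify !map_mxM -!map_trmx.
by apply: finite_eigenvalue_congruence; rewrite row_full_map.
Qed.
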